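(* Let $K$ be an algebraically closed field, complete with respect to a nonarchimedean valuation $\mathrm{val}$, with residue field of characteristic different from $2$ and $3$, let $q\in K^*$ with $\mathrm{val}(q)>0$, and let $\psi:E=K^*/q^{\mathbb{Z}}\to C\subset\mathbb{P}^2$ be a honeycomb embedding. With $\pi:\mathrm{TGL}(\psi)\to \mathrm{trop}(C)\times\mathrm{trop}(C)$, the operation $\circ:\mathrm{trop}(C)\times\mathrm{trop}(C)\to\mathbb{S}^1$, the function $\delta$ and the points $p_1,\ldots,p_9$ as defined in the context (''is a vertex'' refers to the hexagon $\mathbb{S}^1$, and a fiber $\pi^{-1}(U,V)$ is identified with the set of third coordinates $W$ of its points $(U,V,W)$), for any $U,V\in\mathrm{trop}(C)$ exactly one of the following occurs: (1) If $-(U\circ V)$ is not a vertex, then $\pi^{-1}(U,V)$ is the singleton $\{-(U\circ V)\}$. (2) If $-(U\circ V)$ is a vertex adjacent to a single unbounded ray $R_i$ towards the point $p_i$, then $\pi^{-1}(U,V)$ is the set of points on $R_i$ whose distance to $\mathbb{S}^1$ equals $\delta(u^{-1}v^{-1},p_i)$ for some lifts $u,v\in K^*$ of $U$ and $V$. (3) If $-(U\circ V)$ is a vertex adjacent to a bounded segment $B$, along with two rays $R_j$ and $R_k$ towards the points $p_j$ and $p_k$, then $\pi^{-1}(U,V)$ consists of (i) the points on $B$ whose distance to $\mathbb{S}^1$ equals $\delta(u^{-1}v^{-1},p_j)=\delta(u^{-1}v^{-1},p_k)$ for some lifts $u,v\in K^*$ of $U$ and $V$; (ii) the points on $R_j$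 whose distance to $\mathbb{S}^1$ equals $\delta(u^{-1}v^{-1},p_j)>\delta(u^{-1}v^{-1},p_k)$ for some lifts $u,v\in K^*$ of $U$ and $V$; and (iii) the points on $R_k$ whose distance to $\mathbb{S}^1$ equals $\delta(u^{-1}v^{-1},p_k)>\delta(u^{-1}v^{-1},p_j)$ for some lifts $u,v\in K^*$ of $U$ and $V$.
   Context: Honeycomb form: a plane cubic $c_{300}x^3+c_{210}x^2y+c_{120}xy^2+c_{030}y^3+c_{021}y^2z+c_{012}yz^2+c_{003}z^3+c_{102}xz^2+c_{201}x^2z+c_{111}xyz=0$ is in honeycomb form if the nine scalars $\frac{c_{021}c_{102}}{c_{111}c_{012}},\frac{c_{012}c_{120}}{c_{111}c_{021}},\frac{c_{201}c_{012}}{c_{111}c_{102}},\frac{c_{210}c_{021}}{c_{111}c_{120}},\frac{c_{102}c_{210}}{c_{111}c_{201}},\frac{c_{120}c_{201}}{c_{111}c_{210}},\frac{c_{111}c_{003}}{c_{012}c_{102}},\frac{c_{111}c_{030}}{c_{021}c_{120}},\frac{c_{111}c_{300}}{c_{201}c_{210}}$ all have positive valuation. Honeycomb embedding: $\psi$ is an analytic isomorphism of $E=K^*/q^{\mathbb{Z}}$ onto a plane cubic $C$ in honeycomb form, written as $$\psi(x)=\bigl(a\,\Theta_{p_1}\Theta_{p_2}\Theta_{p_3}(x):b\,\Theta_{p_4}\Theta_{p_5}\Theta_{p_6}(x):c\,\Theta_{p_7}\Theta_{p_8}\Theta_{p_9}(x)\bigr)$$ where $\Theta(x)=\prod_{n>0}(1-q^nx)\prod_{n\ge0}(1-q^n/x)$,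 $\Theta_p(x)=\Theta(x/p)$, $a,b,c,p_1,\ldots,p_9\in K^*$, $p_1p_2p_3=p_4p_5p_6=p_7p_8p_9$, $p_i/p_j\notin q^{\mathbb{Z}}$ for $i\ne j$. Let $\mathcal{V}:K^*\to\mathbb{R}/\mathrm{val}(q)\mathbb{Z}\simeq\mathbb{S}^1$ be induced by $\mathrm{val}$. The values $\mathcal{V}(p_1),\dots,\mathcal{V}(p_9)$ occur in cyclic order, with $\mathcal{V}(p_3)=\mathcal{V}(p_4)$, $\mathcal{V}(p_6)=\mathcal{V}(p_7)$, $\mathcal{V}(p_9)=\mathcal{V}(p_1)$ and all other values distinct. Tropicalization: $\mathrm{trop}(z_0:z_1:z_2)=(\mathrm{val}(z_0)-\mathrm{val}(z_2),\mathrm{val}(z_1)-\mathrm{val}(z_2))\in\mathbb{R}^2$ for points with nonzero coordinates; $\mathrm{trop}(C)\subset\mathbb{R}^2$ is the resulting tropical curve, consisting of images of $K$-points of $C$ off the coordinate lines (up to the usual Euclidean closure). It consists of a hexagon together with, at three alternating vertices, one unbounded ray each and, at the other three vertices, a bounded segment whose other end carries two unbounded rays. Each of the nine rays corresponds to (''is towards'') one $p_i$: it is the ray along which $\mathrm{trop}(\psi(x))$ goes to infinity as $x\to p_i$. The hexagon is identified with $\mathbb{S}^1=\mathbb{R}/\mathrm{val}(q)\mathbb{Z}$ (isometrically with respect to lattice length) so that for $x\in K^*$ the retraction of $\mathrm{trop}(\psi(x))$ to the hexagon (i.e. collapsing each tree attached at a vertex to that vertex) is the point corresponding to $\mathcal{V}(x)$.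 For $U,V\in\mathrm{trop}(C)$, $U\circ V\in\mathbb{S}^1$ is the sum in $\mathbb{S}^1$ of the retractions of $U$ and $V$, and $-(U\circ V)$ its inverse in $\mathbb{S}^1$. The distance of a point of $\mathrm{trop}(C)$ to $\mathbb{S}^1$ is the lattice length of the unique path in $\mathrm{trop}(C)$ from it to the hexagon. A scalar $u\in K^*$ is a lift of $U\in\mathrm{trop}(C)$ if $\mathrm{trop}(\psi(u\cdot q^{\mathbb{Z}}))=U$. For $x,y\in K^*$ with $\mathcal{V}(x)=\mathcal{V}(y)$, $\delta(x,y)=\mathrm{val}\bigl(1-\frac{x}{y}q^i\bigr)$, where $i\in\mathbb{Z}$ is the unique integer with $\mathrm{val}(x)+\mathrm{val}(q^i)=\mathrm{val}(y)$. Tropical group law surface: $\mathrm{TGL}(\psi)=\{(\mathrm{trop}(\psi(x)),\mathrm{trop}(\psi(y)),\mathrm{trop}(\psi(z))):x,y,z\in E,\ x\cdot y\cdot z=\mathrm{id}\}\subset(\mathbb{R}^2)^3$ (over triples where all three tropicalizations are defined), and $\pi$ is projection to the first two coordinates.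
   Formalization: U and V range over tropicalizations of K-points of C off the coordinate lines, not the Euclidean closure: if the value group is not all of the reals, other points of the closure have no lifts and an empty fiber, so part (1) fails there. *)

(* Defs.v *)
(* MathComp / MathComp-Analysis *)
From HB Require Import structures.
From mathcomp Require Import all_boot all_order all_algebra.
From mathcomp Require Import all_classical all_reals all_analysis.
Import Order.TTheory GRing.Theory Num.Theory.
Import numFieldNormedType.Exports.

Set Implicit Arguments.
Unset Strict Implicit.
Unset Printing Implicit Defensive.

Local Open Scope classical_set_scope.
Local Open Scope ring_scope.

(* Real-valued nonarchimedean valuation, written additively, [nu 0 = +oo]. *)
Record valuation (R : realType) (K : fieldType) := Valuation {
  vfun :> K -> \bar R;
  vfun_pinfty : forall x, vfun x = +oo%E <-> x = 0;
  vfun_Nninfty : forall x, vfun x != -oo%E;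
  vfunM : forall x y, vfun (x * y) = (vfun x + vfun y)%E;
  vfunD : forall x y, (Order.min (vfun x) (vfun y) <= vfun (x + y)%R)%E
}.

Section ResidueField.
Context (R : realType) (K : fieldType) (v : valuation R K).

Lemma vfun0 : v 0 = +oo%E.
Proof. by apply/vfun_pinfty. Qed.

Lemma vfun_fin x : x != 0 -> v x \is a fin_num.
Proof.
move=> x0; rewrite fin_numE vfun_Nninfty /=.
by apply/eqP => /vfun_pinfty /eqP; rewrite (negbTE x0).
Qed.

Lemma vfun1 : v 1 = 0%E.
Proof.
have := vfunM v 1 1; rewrite mulr1.
have := vfun_fin (oner_neq0 K); case: (v 1) => [r| |] //= _.
rewrite -EFinD => -[] /eqP; rewrite -subr_eq0 opprD addrA subrr add0r.
by rewrite oppr_eq0 => /eqP ->.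
Qed.

Lemma vfunN1 : v (-1) = 0%E.
Proof.
have := vfunM v (-1) (-1); rewrite mulrNN mulr1 vfun1.
have N10 : (-1 : K) != 0 by rewrite oppr_eq0 oner_neq0.
have := vfun_fin N10; case: (v (-1)) => [r| |] //= _.
rewrite -EFinD => -[] /esym /eqP.
by rewrite -mulr2n mulrn_eq0 /= => /eqP ->.
Qed.

Lemma vfunN x : v (- x) = v x.
Proof. by rewrite -mulN1r vfunM vfunN1 add0e. Qed.

Definition val_ring_pred : {pred K} := fun x => (0 <= v x)%E.

Fact val_ring_subring : subring_closed val_ring_pred.
Proof.
split => [|x y|x y]; rewrite /val_ring_pred !unfold_in.
- by rewrite vfun1.
- move=> x0 y0; apply: le_trans (vfunD v _ _).
  by rewrite vfunN le_min x0.
- by move=> x0 y0; rewrite vfunM adde_ge0.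
Qed.

HB.instance Definition _ :=
  GRing.isSubringClosed.Build K val_ring_pred val_ring_subring.

Record val_ring := ValRing { vr_val :> K; vr_valP : vr_val \in val_ring_pred }.

HB.instance Definition _ := [isSub for vr_val].
HB.instance Definition _ := [Choice of val_ring by <:].
HB.instance Definition _ := [SubChoice_isSubComNzRing of val_ring by <:].

Definition max_ideal : {pred val_ring} := fun x => (0 < v (vr_val x))%E.

Fact max_ideal_zmod : zmod_closed max_ideal.
Proof.
split => [|x y]; rewrite /max_ideal !unfold_in.
- by rewrite vfun0 lt0y.
- move=> x0 y0; apply: lt_le_trans (vfunD v _ _).
  by rewrite vfunN lt_min x0.
Qed.

Fact max_ideal_proper :
  1 \notin max_ideal /\ forall a, {in max_ideal, forall u, a * u \in max_ideal}.
Proof.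
split => [|a u]; rewrite /max_ideal !unfold_in.
- by rewrite vfun1 ltxx.
- move=> u0; rewrite /= vfunM; apply: lt_le_trans u0 _.
  by rewrite leeDr //; exact: (vr_valP a).
Qed.

HB.instance Definition _ :=
  GRing.isZmodClosed.Build val_ring max_ideal max_ideal_zmod.
HB.instance Definition _ :=
  isProperIdeal.Build val_ring max_ideal max_ideal_proper.

Definition residue_field := {ideal_quot max_ideal}.

HB.instance Definition _ := GRing.ComNzRing.on residue_field.

End ResidueField.


Section Analysis.
Context (R : realType) (K : fieldType) (nu : valuation R K).

Definition vcvg (u : nat -> K) (l : K) : Prop :=
  forall M : R, exists N : nat, forall n, (N <= n)%N -> (M%:E <= nu (u n - l)%R)%E.

Definition vcauchy (u : nat -> K) : Prop :=
  forall M : R, exists N : nat, forall m n, (N <= m)%N -> (N <= n)%N ->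
    (M%:E <= nu (u m - u n)%R)%E.

Definition vcomplete : Prop := forall u, vcauchy u -> exists l, vcvg u l.

Definition vlim (u : nat -> K) : K := xget 0 [set l | vcvg u l].

(* The real number val(x), meaningful for x != 0. *)
Definition rval (x : K) : R := fine (nu x).

Definition Theta (q x : K) : K :=
  vlim (fun N => \prod_(1 <= n < N.+1) (1 - q ^+ n * x)) *
  vlim (fun N => \prod_(0 <= n < N) (1 - q ^+ n / x)).

Definition qZ (q x : K) : Prop := exists n : int, x = q ^ n.

Definition delta (q x y : K) : \bar R :=
  let i := xget (0 : int) [set i : int | (nu x + nu (q ^ i)%R)%E = nu y] in
  nu (1 - x / y * q ^ i).

(* A triple of homogeneous coordinates is a term of K * K * K. *)
Definition proj_eq (z w : K * K * K) : Prop :=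
  exists2 k : K, k != 0 &
    [/\ w.1.1 = k * z.1.1, w.1.2 = k * z.1.2 & w.2 = k * z.2].

Definition off_axes (z : K * K * K) : Prop :=
  [/\ z.1.1 != 0, z.1.2 != 0 & z.2 != 0].

(* Meaningful only under [off_axes z]. *)
Definition trop (z : K * K * K) : R * R :=
  (rval z.1.1 - rval z.2, rval z.1.2 - rval z.2).

End Analysis.

Section Cubics.
Context (R : realType) (K : fieldType) (nu : valuation R K).
(* [C i j k] is the coefficient of x^i y^j z^k; only i + j + k = 3 is used. *)
Context (C : nat -> nat -> nat -> K).

Definition cubic_form (P : K * K * K) : K :=
  let: (x, y, z) := P in
  C 3 0 0 * x ^+ 3 + C 2 1 0 * x ^+ 2 * y + C 1 2 0 * x * y ^+ 2
  + C 0 3 0 * y ^+ 3 + C 0 2 1 * y ^+ 2 * z + C 0 1 2 * y * z ^+ 2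
  + C 0 0 3 * z ^+ 3 + C 1 0 2 * x * z ^+ 2 + C 2 0 1 * x ^+ 2 * z
  + C 1 1 1 * x * y * z.

(* The point is required to be a genuine point of P^2. *)
Definition on_cubic (P : K * K * K) : Prop :=
  P != (0, 0, 0) /\ cubic_form P = 0.

(* The nonvanishing conditions say that the nine fractions are defined. *)
Definition honeycomb_form : Prop :=
  [/\ all (fun x => x != 0)
        [:: C 1 1 1; C 0 2 1; C 0 1 2; C 1 0 2; C 2 0 1; C 2 1 0; C 1 2 0],
      (0 < nu (C 0 2 1 * C 1 0 2 / (C 1 1 1 * C 0 1 2))%R)%E
      /\ (0 < nu (C 0 1 2 * C 1 2 0 / (C 1 1 1 * C 0 2 1))%R)%E
      /\ (0 < nu (C 2 0 1 * C 0 1 2 / (C 1 1 1 * C 1 0 2))%R)%E,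
      (0 < nu (C 2 1 0 * C 0 2 1 / (C 1 1 1 * C 1 2 0))%R)%E
      /\ (0 < nu (C 1 0 2 * C 2 1 0 / (C 1 1 1 * C 2 0 1))%R)%E
      /\ (0 < nu (C 1 2 0 * C 2 0 1 / (C 1 1 1 * C 2 1 0))%R)%E
    & (0 < nu (C 1 1 1 * C 0 0 3 / (C 0 1 2 * C 1 0 2))%R)%E
      /\ (0 < nu (C 1 1 1 * C 0 3 0 / (C 0 2 1 * C 1 2 0))%R)%E
      /\ (0 < nu (C 1 1 1 * C 3 0 0 / (C 2 0 1 * C 2 1 0))%R)%E].

(* The tropicalizations of the K-points of C off the coordinate lines, without
   taking the Euclidean closure. *)
Definition trop_curve : set (R * R) :=
  [set P | exists z, [/\ on_cubic z, off_axes z & trop nu z = P]].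

Definition monomials : seq (nat * nat * nat) :=
  [:: (3, 0, 0); (2, 1, 0); (1, 2, 0); (0, 3, 0); (0, 2, 1);
      (0, 1, 2); (0, 0, 3); (1, 0, 2); (2, 0, 1); (1, 1, 1)]%N.

Definition center : nat * nat * nat := (1, 1, 1)%N.

Definition trop_monomial (m : nat * nat * nat) (P : R * R) : \bar R :=
  (nu (C m.1.1 m.1.2 m.2) + (m.1.1%:R * P.1 + m.1.2%:R * P.2)%:E)%E.

Definition tmin (P : R * R) (m : nat * nat * nat) : Prop :=
  m \in monomials /\
  forall n, n \in monomials -> (trop_monomial m P <= trop_monomial n P)%E.

(* The closed cell of the tropical curve dual to the segment [m, m'] of the
   Newton subdivision.  The closure of [trop_curve] is the union of the cells
   with m <> m'; the bounded region enclosed by the hexagon is the one where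
   the monomial xyz is minimal. *)
Definition cell (m m' : nat * nat * nat) : set (R * R) :=
  [set P | tmin P m /\ tmin P m'].

Definition hexagon : set (R * R) :=
  [set P | exists2 m, m != center & cell center m P].

Definition hex_vertex (P : R * R) : Prop :=
  exists m m', [/\ m != center, m' != center, m != m',
                   cell center m P & cell center m' P].

Definition outer_edge (E : set (R * R)) : Prop :=
  exists m m', [/\ m != center, m' != center, m != m',
                   E = cell m m' & E !=set0].

Definition is_ray (E : set (R * R)) : Prop :=
  outer_edge E /\ ~ bounded_set E.

Definition is_segment (E : set (R * R)) : Prop :=
  outer_edge E /\ bounded_set E.

(* [t] is the lattice length of the segment [P, Q], of rational slope. *)
Definition lattice_length (P Q : R * R) (t : R) : Prop :=
  exists m n : int, [/\ coprimez m n, 0 <= t,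
    Q.1 = P.1 + t * m%:~R & Q.2 = P.2 + t * n%:~R].

(* The path in the tropical curve from [W] to the hexagon arrives at [h] and
   has lattice length [t]: [W] is on the hexagon, or on an edge attached to the
   hexagon at [h], or on a ray attached to the far end [b] of a bounded segment
   attached to the hexagon at [h]. *)
Definition path_to_hexagon (W h : R * R) (t : R) : Prop :=
  hexagon h /\
  [\/ h = W /\ t = 0,
      exists E, [/\ outer_edge E, E h, E W & lattice_length h W t]
    | exists B E b t1 t2,
        [/\ is_segment B /\ is_ray E, B h, B b /\ E b, E W &
            [/\ lattice_length h b t1, lattice_length b W t2 & t = t1 + t2]]].

Definition retraction (W : R * R) : R * R :=
  xget W [set h | exists t, path_to_hexagon W h t].

Definition hex_distance (W : R * R) : R :=
  xget 0 [set t | exists h, path_to_hexagon W h t].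

(* Vertex with a single unbounded ray, resp. with a bounded segment [B] whose
   other end carries the two rays [E] and [E']. *)
Definition vertex_with_ray (P : R * R) (E : set (R * R)) : Prop :=
  [/\ hex_vertex P, is_ray E, E P & forall E', is_ray E' -> E' P -> E' = E].

Definition vertex_with_segment (P : R * R) (B E E' : set (R * R)) : Prop :=
  [/\ hex_vertex P, is_segment B, B P, (is_ray E /\ is_ray E') /\ E <> E' &
      exists b, [/\ b <> P, B b, E b & E' b]].

End Cubics.

Section Embeddings.
Context (R : realType) (K : fieldType) (nu : valuation R K).
(* [p] is only used at the indices 1, ..., 9. *)
Context (q a b c : K) (p : nat -> K) (C : nat -> nat -> nat -> K).

Definition psi (x : K) : K * K * K :=
  let T i := Theta nu q (x / p i) in
  (a * (T 1%N * T 2%N * T 3%N), b * (T 4%N * T 5%N * T 6%N), c * (T 7%N * T 8%N * T 9%N)).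

(* Cyclic order on R / val(q) Z, for one of the two orientations: the values
   have real lifts, up to a global sign, increasing within one period. *)
Definition cyclic_position : Prop :=
  exists (s : bool) (t : nat -> R),
    (forall i, (1 <= i <= 9)%N ->
       exists n : int, (-1) ^+ s * rval nu (p i) = t i + n%:~R * rval nu q) /\
    [/\ t 1%N < t 2%N < t 3%N, t 3%N = t 4%N, t 4%N < t 5%N < t 6%N, t 6%N = t 7%N
      & t 7%N < t 8%N < t 9%N /\ t 9%N = t 1%N + rval nu q].

(* psi is an analytic isomorphism of E = K^* / q^Z onto C: it is a bijection on
   K-points, analytic through its Theta expression.  Its degree is then one
   (theta sections of degree 3 onto a cubic), so that its inverse is analytic. *)
Record honeycomb_embedding : Prop := HoneycombEmbedding {
  he_abc : [/\ a != 0, b != 0 & c != 0];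
  he_p0 : forall i, (1 <= i <= 9)%N -> p i != 0;
  he_prod : p 1 * p 2 * p 3 = p 4 * p 5 * p 6 /\
            p 4 * p 5 * p 6 = p 7 * p 8 * p 9;
  he_pq : forall i j, (1 <= i <= 9)%N -> (1 <= j <= 9)%N -> i <> j ->
            ~ qZ q (p i / p j);
  he_cyclic : cyclic_position;
  he_form : honeycomb_form nu C;
  he_on : forall x, x != 0 -> on_cubic C (psi x);
  he_inj : forall x y, x != 0 -> y != 0 ->
             (proj_eq (psi x) (psi y) <-> qZ q (x / y));
  he_surj : forall z, on_cubic C z -> exists2 x, x != 0 & proj_eq (psi x) z
}.

Definition trop_psi (x : K) : R * R := trop nu (psi x).

(* [gamma] is the covering map R -> R / val(q) Z followed by the identification
   of the circle with the hexagon. *)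
Record hexagon_identification (gamma : R -> R * R) : Prop :=
  HexagonIdentification {
  hi_periodic : forall s t,
    gamma s = gamma t <-> exists n : int, s - t = n%:~R * rval nu q;
  hi_onto : range gamma = hexagon nu C;
  hi_continuous : continuous gamma;
  hi_isometric : forall m s t, m != center -> s <= t ->
    (forall r, s <= r <= t -> cell nu C center m (gamma r)) ->
    lattice_length (gamma s) (gamma t) (t - s);
  hi_retraction : forall x, x != 0 -> off_axes (psi x) ->
    retraction nu C (trop_psi x) = gamma (rval nu x)
}.

Definition circle_coord (gamma : R -> R * R) (P : R * R) : R :=
  xget 0 [set s | gamma s = retraction nu C P].

(* The point -(U o V) of the circle, as a point of the hexagon. *)
Definition neg_circ (gamma : R -> R * R) (U V : R * R) : R * R :=
  gamma (- (circle_coord gamma U + circle_coord gamma V)).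

Definition towards (E : set (R * R)) (y : K) : Prop :=
  forall M : R, exists N : R, forall x, x != 0 -> x != y ->
    (N%:E <= nu (x - y)%R)%E ->
    [/\ off_axes (psi x), E (trop_psi x) & M <= `|trop_psi x|].

Definition is_lift (u : K) (U : R * R) : Prop :=
  [/\ u != 0, off_axes (psi u) & trop_psi u = U].

Definition TGL : set ((R * R) * (R * R) * (R * R)) :=
  [set T | exists x y z, [/\ is_lift x T.1.1, is_lift y T.1.2, is_lift z T.2
                            & qZ q (x * y * z)]].

Definition TGL_fiber (U V : R * R) : set (R * R) := [set W | TGL (U, V, W)].

End Embeddings.

Definition exactly_one3 (A B D : Prop) : Prop :=
  [/\ [\/ A, B | D], ~ (A /\ B), ~ (A /\ D) & ~ (B /\ D)].

(* Main.v *)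
Require Import Defs.
From mathcomp Require Import all_boot all_order all_algebra.
From mathcomp Require Import all_classical all_reals all_analysis.
From mathcomp Require Import ring lra.
Import Order.TTheory GRing.Theory Num.Theory.
Import numFieldNormedType.Exports.

(** The proof compares two descriptions of the same plane tropical curve.

    The cubic. The inequalities of the honeycomb form say that the heights
    [val c_m] are convex across each of the nine inner edges of the
    triangulation of the Newton triangle into nine unimodular triangles.  Local
    convexity forces the dual tropical curve to have the familiar shape
    ([cell_adjacent]): a hexagon with six vertices, a ray at three of them, and
    at the other three a bounded segment ending in two rays.  The nine boundary
    edges of the Newton triangle number the rays from 1 to 9; [dir i] is the
    direction of ray [i], [vtx i] the vertex of the hexagon that it retracts to,
    and two rays behind the same segment are partners.  Behind a vertex, every
    point is [vtx i + s dir i + s' dir (partner i)], and its distance to the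
    hexagon is the larger of [s] and [s'] ([path_arm], [hex_distance_arm]).

    The parametrization. All factors of the product [Theta] except finitely many
    have valuation zero, so that [val (Theta x)] is a continuous piecewise linear
    function of [val x]; only if [val x] is a multiple of [val q] does one
    factor, [1] minus a unit, contribute an extra term.  Therefore [trop (psi x)]
    is the value at [val x] of a continuous function [F] plus the sum of the
    vectors [delta (x, p_i) dir i] over the [p_i] in the class of [x]
    ([trop_psiE]).

    The comparison. As [x] tends to [p_i], the point [trop (psi x)] escapes in
    the direction [dir i], so that the point of the hexagon of parameter
    [val p_i] carries a ray of this direction; the cyclic order of the classes
    of the [p_i] then leaves only [vtx i] ([gamma_vtx]).  If [val x] is not in
    the class of a [p_i], then [trop (psi x)] does not retract to a vertex and
    therefore lies on the hexagon, at the point of parameter [val x].  Such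
    values are dense, hence [F] is the given parametrization of the hexagon
    ([generic_tropE]), and in the class of [p_i] the coordinates [s] and [s'] of
    [trop (psi x)] are [delta (x, p_i)] and [delta (x, p_k)] for the partner [k]
    ([trop_arm]).

    Finally the fiber over [(U, V)] is the set of all [trop (psi (u v)^-1)] for
    lifts [u] of [U] and [v] of [V] ([fiberP]), and the three cases are read off
    the previous formula. *)

Set Implicit Arguments.
Unset Strict Implicit.
Unset Printing Implicit Defensive.

Local Open Scope classical_set_scope.
Local Open Scope ring_scope.

Local Notation center := Defs.center.

(** * Ultrametric valuations *)

Section Valuation.
Context (R : realType) (K : fieldType) (nu : valuation R K).
Implicit Types x y : K.

Lemma vfunE x : x != 0 -> nu x = (rval nu x)%:E.
Proof. by move=> /(vfun_fin nu) ?; rewrite /rval fineK. Qed.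

Lemma rvalM x y : x != 0 -> y != 0 -> rval nu (x * y) = rval nu x + rval nu y.
Proof. by move=> x0 y0; rewrite {1}/rval vfunM !vfunE. Qed.

Lemma rval1 : rval nu 1 = 0.
Proof. by rewrite /rval vfun1. Qed.

Lemma rvalV x : x != 0 -> rval nu x^-1 = - rval nu x.
Proof.
move=> x0; apply/eqP; rewrite -subr_eq0 opprK addrC -rvalM ?invr_neq0 //.
by rewrite divff // rval1.
Qed.

Lemma rval_div x y : x != 0 -> y != 0 -> rval nu (x / y) = rval nu x - rval nu y.
Proof. by move=> x0 y0; rewrite rvalM ?invr_neq0 // rvalV. Qed.

Lemma rvalX x n : x != 0 -> rval nu (x ^+ n) = n%:R * rval nu x.
Proof.
move=> x0; elim: n => [|n IH]; first by rewrite expr0 rval1 mul0r.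
by rewrite exprS rvalM ?expf_neq0 // IH mulrS mulrDl mul1r.
Qed.

Lemma rval_exprz x (n : int) : x != 0 -> rval nu (x ^ n) = n%:~R * rval nu x.
Proof.
move=> x0; case: n => n; first by rewrite -exprnP rvalX.
by rewrite NegzE -exprnN rvalV ?expf_neq0 // rvalX // mulrNz mulNr.
Qed.

Lemma vfunB_ge x y (M : \bar R) : (M <= nu x)%E -> (M <= nu y)%E -> (M <= nu (x - y)%R)%E.
Proof.
by move=> Mx My; apply: le_trans (vfunD nu _ _); rewrite vfunN le_min Mx.
Qed.

Lemma vfunD_ge x y (M : \bar R) : (M <= nu x)%E -> (M <= nu y)%E -> (M <= nu (x + y)%R)%E.
Proof. by move=> Mx My; apply: le_trans (vfunD nu _ _); rewrite le_min Mx. Qed.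

Lemma vfunD_lt x y : (nu x < nu y)%E -> nu (x + y) = nu x.
Proof.
move=> xy; apply/le_anti/andP; split; last by apply: vfunD_ge => //; exact: ltW.
have : (Order.min (nu (x + y)%R) (nu y) <= nu x)%E.
  by have := vfunD nu (x + y) (- y); rewrite vfunN addrK.
by rewrite ge_min => /orP[//|]; rewrite leNgt xy.
Qed.

Lemma vfunB_lt x y : (nu x < nu y)%E -> nu (x - y) = nu x.
Proof. by rewrite -(vfunN nu y) => /vfunD_lt. Qed.

Lemma vfun_1B w : nu w != 0%E -> nu (1 - w) = Order.min 0%E (nu w).
Proof.
case: ltgtP => // [w0|w0] _; last by rewrite vfunB_lt ?vfun1.
by rewrite -opprB vfunN vfunB_lt ?vfun1.
Qed.

Lemma vfun_1B_ge0 w : (0 <= nu w)%E -> (0 <= nu (1 - w)%R)%E.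
Proof. by move=> w0; apply: vfunB_ge; rewrite ?vfun1. Qed.

Lemma vcvg_vlim (u : nat -> K) : vcomplete nu -> vcauchy nu u -> vcvg nu u (vlim nu u).
Proof.
by move=> /[apply] -[l ul]; rewrite /vlim; case: xgetP => [? _ //|/(_ l)].
Qed.

(** A convergent sequence of constant valuation [c] is eventually closer to
    its limit than [c], so the limit has the same valuation; for [c = +oo] the
    sequence is eventually zero. *)
Lemma vfun_vlim (u : nat -> K) (c : \bar R) (N : nat) : vcvg nu u (vlim nu u) ->
  (forall n, (N <= n)%N -> nu (u n) = c) -> nu (vlim nu u) = c.
Proof.
move=> cv uc; case: c uc => [r| |] uc; last by have := vfun_Nninfty nu (u N); rewrite uc ?eqxx.
  have [m um] := cv (r + 1); set n := maxn N m.
  have nN := leq_maxl N m; have nm := leq_maxr N m.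
  rewrite -(uc _ nN) -[in LHS](subKr (u (maxn N m)) (vlim nu u)) vfunB_lt //.
  by apply: lt_le_trans (um _ nm); rewrite (uc _ nN) lte_fin ltrDl.
have u0 n : (N <= n)%N -> u n = 0 by move=> /uc /(vfun_pinfty nu).
apply: contrapT => /eqP; rewrite -ltey => fin.
have l0 : vlim nu u != 0 by apply: contraTneq fin => ->; rewrite vfun0.
have [m um] := cv (rval nu (vlim nu u) + 1).
have := um _ (leq_maxr N m); rewrite u0 ?leq_maxl // sub0r vfunN vfunE // lee_fin.
by rewrite gerDl ler10.
Qed.

End Valuation.

(** * The valuation of theta *)

Section Theta.
Context (R : realType) (K : fieldType) (nu : valuation R K).
Hypothesis Kcomplete : vcomplete nu.

Lemma vfun_prod (f : nat -> K) n :
  nu (\prod_(0 <= i < n) f i) = (\sum_(0 <= i < n) nu (f i))%E.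
Proof.
elim: n => [|n IH]; first by rewrite !big_geq ?vfun1.
by rewrite !big_nat_recr //= vfunM IH.
Qed.

(** The factors of index at least [N] have valuation zero, so the valuations
    of the partial products are constant from [N] on; the same estimate makes the
    partial products a Cauchy sequence. *)
Lemma vlim_prod (w : nat -> K) (Q s : R) N : 0 < Q -> 0 < N%:R * Q + s ->
  (forall n, ((n%:R * Q + s)%:E <= nu (w n))%E) ->
  nu (vlim nu (fun n => \prod_(0 <= i < n) (1 - w i))) = (\sum_(0 <= i < N) nu (1 - w i)%R)%E.
Proof.
move=> Q0 N0 wge; rewrite -vfun_prod; set u := fun n => \prod_(0 <= i < n) (1 - w i).
have w1 n : (N <= n)%N -> nu (1 - w n) = 0%E.
  move=> Nn; rewrite vfunB_lt ?vfun1 //; apply: lt_le_trans (wge n).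
  by rewrite lte_fin (lt_le_trans N0) // lerD2r ler_pM2r // ler_nat.
have uS n : u n.+1 = u n * (1 - w n) by rewrite /u big_nat_recr.
have uN n : (N <= n)%N -> nu (u n) = nu (u N).
  elim: n => [|n IH]; first by rewrite leqn0 => /eqP ->.
  rewrite leq_eqVlt => /predU1P[->//|Nn]; rewrite uS vfunM IH // w1 // adde0 //.
apply: (vfun_vlim _ uN); apply: (vcvg_vlim Kcomplete) => M.
set b := fine (nu (u N)).
have bu : (b%:E <= nu (u N))%E.
  by rewrite /b; have := vfun_Nninfty nu (u N); case: (nu (u N)) => //= _; exact: leey.
(* Large enough for [b + (N1 Q + s) >= M], where [b] bounds the partial products. *)
pose N1 := (N + Num.truncn ((`|M| + `|b| + `|s|) / Q)).+1.
have N1M : M <= b + (N1%:R * Q + s).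
  have : (`|M| + `|b| + `|s|) / Q < N1%:R.
    have := truncnS_gt ((`|M| + `|b| + `|s|) / Q); move=> /lt_le_trans; apply.
    by rewrite ler_nat /N1 ltnS leq_addl.
  rewrite ltr_pdivrMr // => H.
  have := ler_norm M; have := ler_norm (- b); have := ler_norm (- s); rewrite !normrN => *; lra.
have NN1 : (N <= N1)%N by rewrite /N1 ltnW // ltnS leq_addr.
have close n : (N1 <= n)%N -> (M%:E <= nu (u n - u N1)%R)%E.
  elim: n => [|n IH]; first by rewrite leqn0 => /eqP ->; rewrite subrr vfun0 leey.
  rewrite leq_eqVlt => /predU1P[->|N1n]; first by rewrite subrr vfun0 leey.
  have -> : u n.+1 - u N1 = (u n - u N1) - u n * w n by rewrite uS; ring.
  apply: vfunB_ge; first exact: IH.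
  rewrite vfunM uN ?(leq_trans NN1) //; apply: le_trans (leeD bu (wge n)).
  rewrite -EFinD lee_fin (le_trans N1M) // lerD2l lerD2r ler_pM2r // ler_nat //.
exists N1 => m n mN nN.
have -> : u m - u n = (u m - u N1) - (u n - u N1) by ring.
by apply: vfunB_ge; exact: close.
Qed.

Context (q : K).
Hypotheses (q0 : q != 0) (qpos : (0 < nu q)%E).
Local Notation Q := (rval nu q).

Lemma rval_q_gt0 : 0 < Q.
Proof. by rewrite -lte_fin -vfunE. Qed.

Lemma vfun_Theta x N : x != 0 -> `|rval nu x| < N%:R * Q ->
  nu (Theta nu q x) =
  (\sum_(0 <= i < N) nu (1 - q ^+ i.+1 * x)%R + \sum_(0 <= i < N) nu (1 - q ^+ i / x)%R)%E.
Proof.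
move=> x0 xN; rewrite /Theta vfunM; congr (_ + _)%E.
  rewrite -(@vlim_prod (fun i => q ^+ i.+1 * x) Q (Q + rval nu x)) ?rval_q_gt0 //.
  - by congr (nu (vlim nu _)); apply/funext => n; rewrite big_add1.
  - have := rval_q_gt0; have := ler_norm (- rval nu x); rewrite normrN => *; lra.
  - move=> n; rewrite vfunE ?mulf_neq0 ?expf_neq0 // lee_fin.
    by rewrite rvalM ?expf_neq0 // rvalX // mulrS; lra.
rewrite -(@vlim_prod (fun i => q ^+ i / x) Q (- rval nu x)) ?rval_q_gt0 //.
  by have := ler_norm (rval nu x); lra.
by move=> n; rewrite vfunE ?mulf_neq0 ?invr_neq0 ?expf_neq0 // lee_fin rval_div ?expf_neq0 // rvalX.
Qed.

(** The piecewise linear part of the valuation of theta, cut off at [N]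
    factors; it has this meaning for [|s| < N val q]. *)
Definition ptheta N (s : R) : R :=
  \sum_(0 <= i < N) Num.min 0 (i.+1%:R * Q + s) + \sum_(0 <= i < N) Num.min 0 (i%:R * Q - s).

(** The tropical value of [1 - w] is exact unless [w] is a unit. *)
Lemma vfun_1B_split w : w != 0 ->
  nu (1 - w) = ((Num.min 0 (rval nu w))%:E + (if (rval nu w == 0)%R then nu (1 - w)%R else 0))%E.
Proof.
move=> w0; case: eqP => [e|/eqP e]; first by rewrite e minxx add0e.
by rewrite adde0 vfun_1B vfunE // EFin_min.
Qed.

Lemma sum_if_single (f : nat -> \bar R) N k (c : pred nat) : (k < N)%N ->
  (forall i, c i = (i == k)) -> (\sum_(0 <= i < N) (if c i then f i else 0) = f k)%E.
Proof.
move=> kN ck; rewrite (bigD1_seq k) ?mem_index_iota ?iota_uniq //= ck eqxx big1 ?adde0 //.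
by move=> i /negbTE ik; rewrite ck ik.
Qed.

Lemma sum_if_none (f : nat -> \bar R) N (c : pred nat) :
  (forall i, c i = false) -> (\sum_(0 <= i < N) (if c i then f i else 0) = 0)%E.
Proof. by move=> ck; rewrite big1 // => i _; rewrite ck. Qed.

Lemma vfun_Theta_split x N : x != 0 -> `|rval nu x| < N%:R * Q ->
  nu (Theta nu q x) = ((ptheta N (rval nu x))%:E +
    (\sum_(0 <= i < N) (if (i.+1%:R * Q + rval nu x == 0)%R then nu (1 - q ^+ i.+1 * x)%R else 0) +
     \sum_(0 <= i < N) (if (i%:R * Q - rval nu x == 0)%R then nu (1 - q ^+ i / x)%R else 0)))%E.
Proof.
move=> x0 xN; rewrite (vfun_Theta x0 xN) /ptheta EFinD -!sumEFin addeACA -!big_split /=.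
apply: eq_bigr => i _; congr (_ + _)%E.
  rewrite [LHS]vfun_1B_split ?mulf_neq0 ?expf_neq0 //.
  by rewrite rvalM ?expf_neq0 // rvalX.
rewrite [LHS]vfun_1B_split ?mulf_neq0 ?invr_neq0 ?expf_neq0 //.
by rewrite rval_div ?expf_neq0 // rvalX.
Qed.

Lemma Theta_generic x N : x != 0 -> `|rval nu x| < N%:R * Q ->
  (forall n : int, rval nu x + n%:~R * Q <> 0) ->
  nu (Theta nu q x) = (ptheta N (rval nu x))%:E.
Proof.
move=> x0 xN gen; rewrite (vfun_Theta_split x0 xN) !sum_if_none ?adde0 // => i; apply/negbTE/eqP => e.
  by apply: (gen (- i%:Z)); rewrite mulrNz mulNr; move: e; rewrite -pmulrn; lra.
by apply: (gen i.+1%:Z); move: e; rewrite -pmulrn; lra.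
Qed.

(** Among all factors, only the one with index [n] is [1] minus a unit; for
    [n <= 0] it is [1 - q^-n / x], which differs from [1 - x q^n] by a unit. *)
Lemma Theta_special x N (n : int) : x != 0 -> `|rval nu x| < N%:R * Q ->
  rval nu x + n%:~R * Q = 0 ->
  nu (Theta nu q x) = ((ptheta N (rval nu x))%:E + nu (1 - x * q ^ n)%R)%E.
Proof.
move=> x0 xN; have Q0 := rval_q_gt0; have Qn0 := lt0r_neq0 Q0.
rewrite (vfun_Theta_split x0 xN) => xn; congr (_ + _)%E.
have {}xn : rval nu x = - n%:~R * Q by lra.
have first_sum i : (i.+1%:R * Q + rval nu x == 0) = (i.+1%:Z == n).
  by rewrite xn mulNr subr_eq0 (inj_eq (mulIf Qn0)) pmulrn eqr_int.
have second_sum i : (i%:R * Q - rval nu x == 0) = (i%:Z == - n).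
  by rewrite xn mulNr opprK addr_eq0 -mulNr (inj_eq (mulIf Qn0)) pmulrn -mulrNz eqr_int.
have nN : `|n|%N%:R < N%:R :> R.
  move: xN; rewrite xn mulNr normrN normrM (gtr0_norm Q0) ltr_pM2r //.
  by rewrite natr_absz intr_norm.
rewrite ltr_nat in nN.
case: n xn first_sum second_sum nN => [[|k]|k] xn c1 c2 nN.
- rewrite sum_if_none; last by move=> i; rewrite c1.
  rewrite add0e (@sum_if_single _ _ 0%N _ nN); last by move=> i; rewrite c2 oppr0.
  have nx : nu x = 0%E by rewrite vfunE // xn mulNr mul0r oppr0.
  rewrite expr0 expr0z mulr1 mul1r.
  have -> : 1 - x = - (x * (1 - x^-1)) by rewrite mulrBr mulfV // mulr1 opprB.
  by rewrite vfunN vfunM nx add0e.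
- rewrite (@sum_if_single _ _ k _ (ltnW nN)); last by move=> i; rewrite c1.
  rewrite sum_if_none; last by move=> i; rewrite c2.
  by rewrite adde0 mulrC.
- rewrite sum_if_none; last by move=> i; rewrite c1.
  rewrite add0e (@sum_if_single _ _ k.+1 _ nN); last by move=> i; rewrite c2 NegzE opprK.
  have qk : q ^+ k.+1 != 0 by rewrite expf_neq0.
  rewrite NegzE -exprnN.
  have -> : 1 - x * q ^- k.+1 = - ((x / q ^+ k.+1) * (1 - q ^+ k.+1 / x)).
    rewrite mulrBr mulr1 mulrA divfK // mulfV // opprB //.
  rewrite vfunN vfunM (vfunE nu (x := x / _)) ?mulf_neq0 ?invr_neq0 //.
  rewrite rval_div // rvalX // xn NegzE mulrNz opprK -pmulrn subrr add0e //.
Qed.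

End Theta.

(** * Lattice lengths in the plane *)

Section Coordinates.
Context (R : realType).

Lemma fstD (P Q : R * R) : (P + Q).1 = P.1 + Q.1. Proof. by []. Qed.
Lemma sndD (P Q : R * R) : (P + Q).2 = P.2 + Q.2. Proof. by []. Qed.
Lemma fstZ t (P : R * R) : (t *: P).1 = t * P.1. Proof. by []. Qed.
Lemma sndZ t (P : R * R) : (t *: P).2 = t * P.2. Proof. by []. Qed.
Definition coordE := (fstD, sndD, fstZ, sndZ).

Lemma pair_ext (P Q : R * R) : P.1 = Q.1 -> P.2 = Q.2 -> P = Q.
Proof. by case: P Q => [? ?] [? ?] /= -> ->. Qed.

Lemma coord_eq (P Q : R * R) : P = Q -> P.1 = Q.1 /\ P.2 = Q.2.
Proof. by move=> ->. Qed.

End Coordinates.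

Section Lattice.
Context (R : realType).

Definition primitive (d : R * R) :=
  exists m n : int, coprimez m n /\ d = (m%:~R, n%:~R).

Lemma lattice_lengthP (P d : R * R) s : primitive d -> 0 <= s ->
  lattice_length P (P + s *: d) s.
Proof.
by move=> [m [n [mn ->]]] s0; exists m, n; split.
Qed.

(** Two primitive vectors spanning the same ray are equal: each of them is an
    integral multiple of the other by a Bezout relation. *)
Lemma lattice_length_unique (P d : R * R) s t : primitive d -> 0 <= s ->
  lattice_length P (P + s *: d) t -> t = s.
Proof.
move=> [m0 [n0 [mn0 ->]]] s0 [m [n [mn t0]]]; rewrite !coordE /= => /addrI e1 /addrI e2.
have key (u v : R) (k l k' l' : int) : 0 <= u -> coprimez k l ->
    u * k%:~R = v * k'%:~R -> u * l%:~R = v * l'%:~R -> exists r : int, u = v * r%:~R.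
  move=> u0 /coprimezP[[x y] /= xy] eu ev; exists (x * k' + y * l').
  have xyR : x%:~R * k%:~R + y%:~R * l%:~R = 1 :> R by rewrite -!intrM -intrD xy.
  have -> : u = u * (x%:~R * k%:~R + y%:~R * l%:~R) by rewrite xyR mulr1.
  transitivity (x%:~R * (u * k%:~R) + y%:~R * (u * l%:~R)); first by ring.
  by rewrite eu ev intrD !intrM; ring.
have [k tk] := key t s _ _ _ _ t0 mn (esym e1) (esym e2).
have [l sl] := key s t _ _ _ _ s0 mn0 e1 e2.
have [s_eq0|s_neq0] := eqVneq s 0; first by rewrite tk s_eq0 mul0r.
have : (k * l)%:~R = 1 :> R.
  by apply: (mulfI s_neq0); rewrite mulr1 intrM mulrA -tk -sl.
move/eqP; rewrite -[1]/(1%:~R) eqr_int => /eqP kl.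
have k0 : 0 <= k by move: t0; rewrite tk pmulr_rge0 ?ler0z // lt0r s_neq0.
have : (k %| 1)%Z by apply/dvdzP; exists l; rewrite mulrC.
by rewrite dvdz1 => /eqP k1; rewrite tk -(gez0_abs k0) k1 mulr1.
Qed.
End Lattice.

(** * The tropical curve of a cubic in honeycomb form *)

Ltac split_ands := repeat match goal with
  | H : _ /\ _ |- _ => destruct H
  | H : and3 _ _ _ |- _ => destruct H
  | H : and4 _ _ _ _ |- _ => destruct H
  | H : and5 _ _ _ _ _ |- _ => destruct H
  end.

Section Honeycomb.
Context (R : realType) (K : fieldType) (nu : valuation R K).
Context (C : nat -> nat -> nat -> K).
Hypothesis C_form : honeycomb_form nu C.
Hypothesis C_corner : all (fun x => x != 0) [:: C 3 0 0; C 0 3 0; C 0 0 3].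

Definition height (m : nat * nat * nat) : R := rval nu (C m.1.1 m.1.2 m.2).

(** The value of a tropical monomial, as a real number; the coefficients of a
    cubic in honeycomb form with nonzero corners are all nonzero. *)
Definition tropval (W : R * R) (m : nat * nat * nat) : R :=
  height m + (m.1.1%:R * W.1 + m.1.2%:R * W.2).

Lemma nu_height m : m \in monomials -> nu (C m.1.1 m.1.2 m.2) = (height m)%:E.
Proof.
move=> mM; rewrite /height /rval fineK //; apply: vfun_fin.
case: C_form => /=; do 7 (case/andP => ?); move=> _ _ _ _; case/and4P: C_corner => ? ? ? _.
by move: mM; rewrite /monomials !inE; do 9 (case/orP => [/eqP -> //|]); move=> /eqP ->.
Qed.

Lemma tmin_height W m : tmin nu C W m <->
  m \in monomials /\ forall n, n \in monomials -> tropval W m <= tropval W n.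
Proof.
split=> -[mM H]; split=> // n nM; have := H n nM;
  by rewrite /trop_monomial !nu_height // -!EFinD lee_fin.
Qed.

Local Notation tv W i j k := (tropval W (i%N, j%N, k%N)).

Lemma tmin_le W m : tmin nu C W m ->
  [/\ [/\ tropval W m <= tv W 3 0 0, tropval W m <= tv W 2 1 0 & tropval W m <= tv W 1 2 0],
      [/\ tropval W m <= tv W 0 3 0, tropval W m <= tv W 0 2 1 & tropval W m <= tv W 0 1 2],
      [/\ tropval W m <= tv W 0 0 3, tropval W m <= tv W 1 0 2 & tropval W m <= tv W 2 0 1]
    & tropval W m <= tv W 1 1 1].
Proof. by case/tmin_height => mM H /=; split; [split..|]; apply: H. Qed.

Lemma height_lt a b d e :
  (0 < nu (C a.1.1 a.1.2 a.2 * C b.1.1 b.1.2 b.2 / (C d.1.1 d.1.2 d.2 * C e.1.1 e.1.2 e.2))%R)%E ->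
  [&& a \in monomials, b \in monomials, d \in monomials & e \in monomials] ->
  height d + height e < height a + height b.
Proof.
move=> H /and4P[aM bM dM eM].
have nz m : m \in monomials -> C m.1.1 m.1.2 m.2 != 0.
  by move=> /nu_height mE; apply/eqP => C0; move: mE; rewrite C0 vfun0.
move: H; set x := _ * C b.1.1 _ _; set y := _ * C e.1.1 _ _ => H.
have y0 : y != 0 by rewrite mulf_neq0 ?nz.
have : nu x = (nu (x / y)%R + nu y)%E by rewrite -vfunM divfK.
move: H; case: (nu (x / y)) => [r| |] //; rewrite /x /y !vfunM !nu_height //.
by rewrite lte_fin -!EFinD => r0 [->]; rewrite ltrDr.
Qed.

Local Notation ht i j k := (height (i%N, j%N, k%N)).

Lemma height_ineqs :
  [/\ [/\ ht 1 1 1 + ht 0 1 2 < ht 0 2 1 + ht 1 0 2,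
          ht 1 1 1 + ht 0 2 1 < ht 0 1 2 + ht 1 2 0 &
          ht 1 1 1 + ht 1 0 2 < ht 2 0 1 + ht 0 1 2],
      [/\ ht 1 1 1 + ht 1 2 0 < ht 2 1 0 + ht 0 2 1,
          ht 1 1 1 + ht 2 0 1 < ht 1 0 2 + ht 2 1 0 &
          ht 1 1 1 + ht 2 1 0 < ht 1 2 0 + ht 2 0 1] &
      [/\ ht 0 1 2 + ht 1 0 2 < ht 1 1 1 + ht 0 0 3,
          ht 0 2 1 + ht 1 2 0 < ht 1 1 1 + ht 0 3 0 &
          ht 2 0 1 + ht 2 1 0 < ht 1 1 1 + ht 3 0 0]].
Proof.
case: C_form => _ [h1 [h2 h3]] [h4 [h5 h6]] [h7 [h8 h9]].
split; split;
  match goal with |- is_true (height ?d + height ?e < height ?a + height ?b) =>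
    by apply: (@height_lt a b d e) end.
Qed.

(** An affine function of the exponent can be added to the heights without
    changing these inequalities, since both sides have the same total exponent.
    This eliminates the coordinates of [W] from all later case distinctions. *)
Lemma tropval_convex W :
  [/\ [/\ tv W 1 1 1 + tv W 0 1 2 < tv W 0 2 1 + tv W 1 0 2,
          tv W 1 1 1 + tv W 0 2 1 < tv W 0 1 2 + tv W 1 2 0 &
          tv W 1 1 1 + tv W 1 0 2 < tv W 2 0 1 + tv W 0 1 2],
      [/\ tv W 1 1 1 + tv W 1 2 0 < tv W 2 1 0 + tv W 0 2 1,
          tv W 1 1 1 + tv W 2 0 1 < tv W 1 0 2 + tv W 2 1 0 &
          tv W 1 1 1 + tv W 2 1 0 < tv W 1 2 0 + tv W 2 0 1] &
      [/\ tv W 0 1 2 + tv W 1 0 2 < tv W 1 1 1 + tv W 0 0 3,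
          tv W 0 2 1 + tv W 1 2 0 < tv W 1 1 1 + tv W 0 3 0 &
          tv W 2 0 1 + tv W 2 1 0 < tv W 1 1 1 + tv W 3 0 0]].
Proof. by have Hh := height_ineqs; rewrite /tropval /=; split_ands; do 2 split; lra. Qed.

(** The boundary of the Newton triangle, traversed along [x = 0], [y = 0] and
    [z = 0].  Index [i] is chosen so that the edge from [walk i.-1] to [walk i] is
    dual to the ray towards [p i]; the corners have the indices 0, 3, 6 and 9.  The
    last two entries repeat the first two, which makes the corner 9 look like the
    corners 3 and 6. *)
Definition boundary_walk : seq (nat * nat * nat) :=
  [:: (0,3,0); (0,2,1); (0,1,2); (0,0,3); (1,0,2); (2,0,1); (3,0,0); (2,1,0); (1,2,0); (0,3,0); (0,2,1)]%N.
Definition walk i := nth center boundary_walk i.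

(** The edges of the triangulation that avoid the center: the nine boundary
    edges, and the three edges that cut off a corner. *)
Definition adjacent m m' :=
  has (fun i => ((m, m') == (walk i.-1, walk i)) || ((m', m) == (walk i.-1, walk i))) (iota 1 9) ||
  has (fun i => ((m, m') == (walk i.-1, walk i.+1)) || ((m', m) == (walk i.-1, walk i.+1))) [:: 3;6;9]%N.

(** If two monomials that are not joined by an edge were both minimal, the nine
    local convexity inequalities could be combined to a contradiction. *)
Lemma cell_adjacent W m m' : m != center -> m' != center -> m != m' ->
  cell nu C m m' W -> adjacent m m'.
Proof.
move=> mc m'c mm' [Wm Wm'].
have := tmin_le Wm; have := tmin_le Wm'; have := tropval_convex W.
case: Wm Wm' => + _ [+ _]; rewrite !inE.
move=> mM m'M; move: mM m'M mc m'c mm'.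
do 9?case/orP; move=> /eqP->; do 9?case/orP; move=> /eqP-> mc m'c mm' //;
  clear mc m'c mm';
  move: (tv W 3 0 0) (tv W 2 1 0) (tv W 1 2 0) (tv W 0 3 0) (tv W 0 2 1)
    (tv W 0 1 2) (tv W 0 0 3) (tv W 1 0 2) (tv W 2 0 1) (tv W 1 1 1) => *;
  exfalso; split_ands.
all: lra.
Qed.

Definition compatible m m' := (m == m') || adjacent m m'.

Lemma cell_compatible W m m' : m != center -> m' != center ->
  tmin nu C W m -> tmin nu C W m' -> compatible m m'.
Proof.
move=> mc m'c mW m'W; rewrite /compatible; have [//|mm'] := eqVneq m m'.
exact: (@cell_adjacent W).
Qed.

Definition dir i : R * R :=
  if (i <= 3)%N then (1, 0) else if (i <= 6)%N then (0, 1) else (-1, -1).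

(** Vertices of the hexagon: the solution of the two linear equations dual to
    the triangle formed by the center and an edge.  It occurs twice in the list
    when the edge cuts off a corner. *)
Definition vtx i : R * R := nth (0, 0)
  [:: (0, 0);
      (ht 0 2 1 - ht 1 2 0, ht 1 1 1 - ht 1 2 0);
      (ht 0 1 2 - ht 1 1 1, ht 0 1 2 - ht 0 2 1);
      (ht 0 1 2 - ht 1 1 1, ht 1 0 2 - ht 1 1 1);
      (ht 0 1 2 - ht 1 1 1, ht 1 0 2 - ht 1 1 1);
      (ht 1 0 2 - ht 2 0 1, ht 1 0 2 - ht 1 1 1);
      (ht 1 1 1 - ht 2 1 0, ht 2 0 1 - ht 2 1 0);
      (ht 1 1 1 - ht 2 1 0, ht 2 0 1 - ht 2 1 0);
      (ht 1 1 1 - ht 2 1 0, ht 1 1 1 - ht 1 2 0);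
      (ht 0 2 1 - ht 1 2 0, ht 1 1 1 - ht 1 2 0)] i.

(** Length of the bounded segment behind [vtx i], zero if the ray [i] is
    attached to the hexagon. *)
Definition len i : R := nth 0
  [:: 0; ht 0 3 0 + ht 1 1 1 - ht 1 2 0 - ht 0 2 1; 0;
      ht 0 0 3 + ht 1 1 1 - ht 1 0 2 - ht 0 1 2;
      ht 0 0 3 + ht 1 1 1 - ht 1 0 2 - ht 0 1 2; 0;
      ht 3 0 0 + ht 1 1 1 - ht 2 1 0 - ht 2 0 1;
      ht 3 0 0 + ht 1 1 1 - ht 2 1 0 - ht 2 0 1; 0;
      ht 0 3 0 + ht 1 1 1 - ht 1 2 0 - ht 0 2 1] i.

(** The other ray behind the same bounded segment, or [i] itself. *)
Definition partner i := nth 0%N [:: 0; 9; 2; 4; 3; 5; 7; 6; 8; 1]%N i.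

(** The direction of the bounded segment is the sum of the directions of the
    two rays at its far end, by the balancing condition. *)
Definition foot i := vtx i + len i *: (dir i + dir (partner i)).

Definition ray i := cell nu C (walk i.-1) (walk i).
Definition seg i := cell nu C (walk i.-1) (walk i.+1).

Lemma cellE m m' W : m \in monomials -> m' \in monomials ->
  cell nu C m m' W <->
  tropval W m = tropval W m' /\ forall n, n \in monomials -> tropval W m <= tropval W n.
Proof.
move=> mM m'M; split=> [[/tmin_height[_ H] /tmin_height [_ H']]|[e H]].
  by split=> //; apply/le_anti; rewrite H ?H'.
by split; apply/tmin_height; split => //; rewrite -e.
Qed.

Lemma in_monomials (P : nat * nat * nat -> Prop) :
  [/\ [/\ P (3, 0, 0), P (2, 1, 0) & P (1, 2, 0)], [/\ P (0, 3, 0), P (0, 2, 1) & P (0, 1, 2)],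
      [/\ P (0, 0, 3), P (1, 0, 2) & P (2, 0, 1)] & P (1, 1, 1)]%N ->
  forall n, n \in monomials -> P n.
Proof.
move=> H n; rewrite !inE; split_ands.
by do 9?case/orP; move=> /eqP->.
Qed.

(** Third vertex of the triangle on the boundary edge dual to the ray [i]. *)
Definition apex i := if partner i == i then center else
  nth center [:: center; (1,2,0); center; (1,0,2); (0,1,2); center; (2,1,0); (2,0,1); center; (0,2,1)]%N i.

Lemma index_cases (P : nat -> Prop) :
  [/\ [/\ P 1, P 2 & P 3], [/\ P 4, P 5 & P 6] & [/\ P 7, P 8 & P 9]]%N ->
  forall i, (1 <= i <= 9)%N -> P i.
Proof. by move=> H i; split_ands; do 10!(case: i => [|i] //). Qed.

Ltac gen_heights := move: (ht 3 0 0) (ht 2 1 0) (ht 1 2 0) (ht 0 3 0) (ht 0 2 1)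
  (ht 0 1 2) (ht 0 0 3) (ht 1 0 2) (ht 2 0 1) (ht 1 1 1).

Lemma apex_monomial i : (1 <= i <= 9)%N -> apex i \in monomials.
Proof. by move: i; apply: index_cases; do 2!split. Qed.

Lemma walk_monomial i : (1 <= i <= 9)%N -> (walk i.-1 \in monomials) * (walk i \in monomials).
Proof. by move: i; apply: index_cases; do 2!split. Qed.

(** The parameter along a ray is recovered from how far the central monomial is
    from being minimal, which grows with unit speed. *)
Lemma ray_param i W : (1 <= i <= 9)%N -> ray i W ->
  let t := tropval W center - tropval W (walk i) - len i in
  0 <= t /\ W = foot i + t *: dir i.
Proof.
move=> i9; have := apex_monomial i9.
rewrite /ray cellE ?walk_monomial // => aM [e Hc]; move: e (Hc center isT) (Hc _ aM).
case: W {Hc aM} => X Y.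
move: i i9; apply: index_cases; split; split; rewrite /foot /vtx /len /dir /tropval /=; gen_heights => *.
all: split; last apply: pair_ext; rewrite ?coordE /=; lra.
Qed.

Lemma ray_mem i W t : (1 <= i <= 9)%N -> 0 <= t -> W = foot i + t *: dir i -> ray i W.
Proof.
move=> i9 t0 eW; rewrite /ray cellE ?walk_monomial //.
have := height_ineqs.
have := congr1 fst eW; have := congr1 snd eW; case: W {eW} => X Y.
rewrite /foot !coordE; move: i i9; apply: index_cases; split; split;
  rewrite /foot /vtx /len /dir /=; move=> eY eX Hh;
  (split; [|apply: in_monomials; do 2?split]; rewrite /tropval /=;
   move: eX eY Hh; gen_heights => *; split_ands).
all: lra.
Qed.

Lemma corner_cases (P : nat -> Prop) : P 3%N -> P 6%N -> P 9%N ->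
  forall j, (j \in [:: 3; 6; 9])%N -> P j.
Proof. by move=> ? ? ? k; rewrite !inE => /or3P[] /eqP->. Qed.

Lemma seg_param j W : (j \in [:: 3; 6; 9])%N -> seg j W ->
  let t := tropval W center - tropval W (walk j.+1) in
  0 <= t <= len j /\ W = vtx j + t *: (dir j + dir (partner j)).
Proof.
move=> jS.
have jM : (walk j.-1 \in monomials) * (walk j.+1 \in monomials) * (walk j \in monomials).
  by move: j jS; exact: corner_cases.
rewrite /seg cellE ?jM // => -[e Hc]; move: e (Hc center isT) (Hc (walk j) jM.2).
case: W {Hc jM} => X Y.
move: j jS; apply: corner_cases; rewrite /vtx /len /dir /tropval /=; gen_heights => *.
all: split; last apply: pair_ext; rewrite ?coordE /=; lra.
Qed.

Lemma seg_mem j W t : (j \in [:: 3; 6; 9])%N -> 0 <= t <= len j ->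
  W = vtx j + t *: (dir j + dir (partner j)) -> seg j W.
Proof.
move=> jS /andP[t0 tl] eW.
have jM : (walk j.-1 \in monomials) * (walk j.+1 \in monomials) * (walk j \in monomials).
  by move: j jS {eW tl}; exact: corner_cases.
rewrite /seg cellE ?jM //; have := height_ineqs.
have := congr1 fst eW; have := congr1 snd eW; case: W {eW} => X Y.
rewrite !coordE; move: j jS tl {jM}; apply: corner_cases;
  rewrite /vtx /len /dir /=; move=> tl eY eX Hh;
  (split; [|apply: in_monomials; do 2?split]; rewrite /tropval /=;
   move: tl eX eY Hh; gen_heights => *; split_ands).
all: lra.
Qed.

Lemma dir_primitive i : primitive (dir i).
Proof.
rewrite /dir; case: ifP => _; last case: ifP => _.
- by exists 1, 0.
- by exists 0, 1.
- by exists (-1), (-1).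
Qed.

Lemma spine_primitive j : (j \in [:: 3; 6; 9])%N -> primitive (dir j + dir (partner j)).
Proof.
move: j; apply: corner_cases; rewrite /dir /=.
- exists 1, 1; split=> //; apply: pair_ext; rewrite coordE /=; lra.
- exists (-1), 0; split=> //; apply: pair_ext; rewrite coordE /=; lra.
- exists 0, (-1); split=> //; apply: pair_ext; rewrite coordE /=; lra.
Qed.

Lemma len_ge0 i : (1 <= i <= 9)%N -> 0 <= len i ?= iff (partner i == i).
Proof.
move: i; apply: index_cases; split; split; apply/leifP; rewrite /len /=.
all: move: height_ineqs; gen_heights => *; split_ands; lra.
Qed.

Lemma partner_range i : (1 <= i <= 9)%N -> (1 <= partner i <= 9)%N.
Proof. by move: i; apply: index_cases; do 2!split. Qed.

Lemma vtx_partner i : (1 <= i <= 9)%N -> vtx (partner i) = vtx i.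
Proof. by move: i; apply: index_cases; do 2!split. Qed.

Lemma len_partner i : (1 <= i <= 9)%N -> len (partner i) = len i.
Proof. by move: i; apply: index_cases; do 2!split. Qed.

Lemma partnerK i : (1 <= i <= 9)%N -> partner (partner i) = i.
Proof. by move: i; apply: index_cases; do 2!split. Qed.

Lemma foot_partner i : (1 <= i <= 9)%N -> foot (partner i) = foot i.
Proof.
by move=> i9; rewrite /foot vtx_partner // len_partner // partnerK // [dir (partner i) + _]addrC.
Qed.

Lemma corner_range j : (j \in [:: 3; 6; 9])%N -> (1 <= j <= 9)%N.
Proof. by move: j; apply: corner_cases. Qed.

Lemma hexagon_tmin h : hexagon nu C h -> tmin nu C h center.
Proof. by case=> m _ []. Qed.

Lemma tmin_mono h m : tmin nu C h m -> forall n, n \in monomials -> tropval h m <= tropval h n.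
Proof. by case/tmin_height. Qed.

(** On the hexagon the central monomial is minimal, so the distance given by
    [ray_param] and the length of the segment both vanish. *)
Lemma hexagon_ray i h : (1 <= i <= 9)%N -> hexagon nu C h -> ray i h ->
  partner i = i /\ h = vtx i.
Proof.
move=> i9 /hexagon_tmin hc /(ray_param i9)[].
have := tmin_mono hc (walk_monomial i9).2; have := len_ge0 i9.
set t := (tropval h center - _ - _) => -[len0 len0E] le0 t0 hE.
have t00 : t = 0 by apply/le_anti; rewrite t0 /t; lra.
have l0 : len i = 0 by apply/le_anti; rewrite len0 andbT; move: t0; rewrite /t; lra.
split; first by apply/eqP; rewrite -len0E l0.
by rewrite hE t00 /foot l0 !scale0r !addr0.
Qed.

Lemma hexagon_seg j h : (j \in [:: 3; 6; 9])%N -> hexagon nu C h -> seg j h -> h = vtx j.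
Proof.
move=> jS /hexagon_tmin hc /(seg_param jS)[/andP[t0 _] hE].
have jM : walk j.+1 \in monomials by move: j jS {t0 hE}; exact: corner_cases.
have := tmin_mono hc jM => le0; rewrite hE.
suff -> : tropval h center - tropval h (walk j.+1) = 0 by rewrite scale0r addr0.
by apply/le_anti; rewrite t0 andbT; lra.
Qed.

Lemma cellC m m' : cell nu C m m' = cell nu C m' m.
Proof. by apply/seteqP; split=> W [? ?]; split. Qed.

Lemma outer_edge_cases E : outer_edge nu C E ->
  (exists2 i, (1 <= i <= 9)%N & E = ray i) \/
  (exists2 j, (j \in [:: 3; 6; 9])%N & E = seg j).
Proof.
move=> [m [m' [mc m'c mm' -> [W mW]]]].
have /orP[/hasP[i + b]|/hasP[j jS b]] := cell_adjacent mc m'c mm' mW.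
  rewrite mem_iota => i9; left; exists i => //.
  by case/orP: b => /eqP[-> ->]; rewrite // cellC.
by right; exists j => //; case/orP: b => /eqP[-> ->]; rewrite // cellC.
Qed.

Lemma rayP i W : (1 <= i <= 9)%N ->
  ray i W <-> exists2 t, 0 <= t & W = foot i + t *: dir i.
Proof.
move=> i9; split=> [/(ray_param i9)[t0 ->]|[t t0]].
  by eexists; first exact: t0.
exact: ray_mem.
Qed.

Lemma segP j W : (j \in [:: 3; 6; 9])%N ->
  seg j W <-> exists2 t, 0 <= t <= len j & W = vtx j + t *: (dir j + dir (partner j)).
Proof.
move=> jS; split=> [/(seg_param jS)[t0 ->]|[t t0]].
  by eexists; first exact: t0.
exact: seg_mem.
Qed.

Lemma ray_outer i : (1 <= i <= 9)%N -> (walk i.-1 != center) && (walk i != center).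
Proof. by move: i; apply: index_cases; do 2!split. Qed.

Lemma seg_outer j : (j \in [:: 3; 6; 9])%N ->
  (walk j.-1 != center) && (walk j.+1 != center).
Proof. by move: j; apply: corner_cases. Qed.

(** Only the rays at the far end of the segment have compatible dual edges. *)
Lemma ray_seg i j b : (1 <= i <= 9)%N -> (j \in [:: 3; 6; 9])%N -> ray i b -> seg j b ->
  ((i == j) || (i == partner j)) /\ b = foot i.
Proof.
move=> i9 jS rb sb; have [/andP[i1 i2] /andP[j1 j2]] := (ray_outer i9, seg_outer jS).
have ij : (i == j) || (i == partner j).
  have := And4 (cell_compatible i1 j1 rb.1 sb.1) (cell_compatible i1 j2 rb.1 sb.2)
               (cell_compatible i2 j1 rb.2 sb.1) (cell_compatible i2 j2 rb.2 sb.2).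
  move: j jS {rb sb i1 i2 j1 j2}; apply: corner_cases;
    by move: i i9; apply: index_cases; split; split; case.
split=> //; have j9 := corner_range jS.
have fij : foot i = foot j by case/orP: ij => /eqP ->; rewrite ?foot_partner.
rewrite fij; move/(rayP _ i9): rb => [t t0 /coord_eq bi]; move/(segP _ jS): sb => [s /andP[s0 sl] bj].
suff sE : s = len j by rewrite bj sE.
apply/le_anti; rewrite sl /=; move/coord_eq: bj => bj; move: bi.
rewrite fij /foot; move: bj; rewrite !coordE; case: (vtx j) => x y; move: (len j) => l.
case: b => X Y; case/orP: ij => /eqP ->; move: j jS {i1 i2 j1 j2 j9 fij sl}; apply: corner_cases;
  by rewrite /partner /dir /= => -[? ?] [? ?]; lra.
Qed.

Lemma foot_single i : (1 <= i <= 9)%N -> partner i = i -> foot i = vtx i.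
Proof.
move=> i9 pi; have [_] := len_ge0 i9; rewrite pi eqxx => /eqP l0.
by rewrite /foot -l0 scale0r addr0.
Qed.

Lemma ray_foot i : (1 <= i <= 9)%N -> ray i (foot i).
Proof. by move=> i9; apply/(rayP _ i9); exists 0; rewrite ?scale0r ?addr0. Qed.

Lemma seg_vtx j : (j \in [:: 3; 6; 9])%N -> seg j (vtx j).
Proof.
move=> jS; apply/(segP _ jS); exists 0; rewrite ?scale0r ?addr0 // lexx.
by have [-> _] := len_ge0 (corner_range jS).
Qed.

Lemma seg_foot j : (j \in [:: 3; 6; 9])%N -> seg j (foot j).
Proof.
move=> jS; apply/(segP _ jS); exists (len j) => //; rewrite lexx andbT.
by have [-> _] := len_ge0 (corner_range jS).
Qed.

Lemma norm_pair (P : R * R) : `|P| = Num.max `|P.1| `|P.2|.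
Proof. by []. Qed.

Lemma norm_dir_gt i (P : R * R) (M : R) : exists2 t, 0 <= t & M < `|P + t *: dir i|.
Proof.
exists (`|P.1| + `|P.2| + `|M| + 1); first by rewrite !addr_ge0.
rewrite norm_pair !coordE lt_max !lter_normr.
have := ler_norm M; have := ler_norm P.1; have := ler_norm (- P.1); have := ler_norm P.2.
have := ler_norm (- P.2); rewrite !normrN; have := normr_ge0 P.2; have := normr_ge0 P.1.
case: P => x y; rewrite /dir; case: ifP => _; last case: ifP => _; rewrite /= => *.
- by apply/orP; left; apply/orP; left; lra.
- by apply/orP; right; apply/orP; left; lra.
- by apply/orP; left; apply/orP; right; lra.
Qed.

Lemma ray_unbounded i : (1 <= i <= 9)%N -> ~ bounded_set (ray i).
Proof.
move=> i9 [M [_ bM]]; have [t t0] := norm_dir_gt i (foot i) (M + 1).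
apply/negP; rewrite -leNgt; apply: (bM (M + 1)); first by rewrite ltrDl.
by apply/(rayP _ i9); exists t.
Qed.

Lemma seg_bounded j : (j \in [:: 3; 6; 9])%N -> bounded_set (seg j).
Proof.
move=> jS; exists (`|(vtx j).1| + `|(vtx j).2| + len j); split; first exact: num_real.
move=> M ltM W /(segP _ jS)[t /andP[t0 tl] ->] /=.
rewrite norm_pair !coordE ge_max !ler_norml.
have := ler_norm (vtx j).1; have := ler_norm (- (vtx j).1); rewrite normrN.
have := ler_norm (vtx j).2; have := ler_norm (- (vtx j).2); rewrite normrN.
move: ltM tl; case: (vtx j) => x y; move: (len j) => l.
move: j jS; apply: corner_cases; rewrite /dir /= => *; apply/andP; split; apply/andP; split; lra.
Qed.

Lemma outer_ray i : (1 <= i <= 9)%N -> outer_edge nu C (ray i).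
Proof.
move=> i9; exists (walk i.-1), (walk i); split => //; last by exists (foot i); exact: ray_foot.
all: by move: i i9; apply: index_cases; do 2!split.
Qed.

Lemma outer_seg j : (j \in [:: 3; 6; 9])%N -> outer_edge nu C (seg j).
Proof.
move=> jS; exists (walk j.-1), (walk j.+1); split => //; last by exists (foot j); exact: seg_foot.
all: by move: j jS; apply: corner_cases.
Qed.

Lemma is_rayP E : is_ray nu C E <-> exists2 i, (1 <= i <= 9)%N & E = ray i.
Proof.
split=> [[/outer_edge_cases[//|[j jS ->]] []]|[i i9 ->]]; first exact: seg_bounded.
by split; [exact: outer_ray|exact: ray_unbounded].
Qed.

Lemma is_segmentP E : is_segment nu C E <-> exists2 j, (j \in [:: 3; 6; 9])%N & E = seg j.
Proof.
split=> [[/outer_edge_cases[[i i9 ->]|//] b]|[j jS ->]]; first by case: (ray_unbounded i9).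
by split; [exact: outer_seg|exact: seg_bounded].
Qed.

(** Coordinates [s >= s'] of a point behind the vertex [vtx i], on the side of
    the ray [i]: on the segment they agree, and on the ray the smaller one is
    stuck at the length of the segment.  With [len i = 0] this also covers a ray
    attached to the hexagon. *)
Definition arm i (s s' : R) := [/\ 0 <= s', s' <= len i, s' <= s & (s = s') \/ (s' = len i)].
Definition arm_pt i s s' : R * R := vtx i + s *: dir i + s' *: dir (partner i).

Lemma double_index_corner i : (1 <= i <= 9)%N -> partner i <> i ->
  exists2 j, (j \in [:: 3; 6; 9])%N & i = j \/ i = partner j.
Proof.
move: i; apply: index_cases; split; split => //= _.
all: try by exists 3%N => //; auto.
all: try by exists 6%N => //; auto.
all: try by exists 9%N => //; auto.
Qed.

Lemma partner_corner j : (j \in [:: 3; 6; 9])%N -> partner j <> j.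
Proof. by move: j; apply: corner_cases. Qed.

Lemma arm_outer i s s' : (1 <= i <= 9)%N -> arm i s s' ->
  ray i (arm_pt i s s') \/
  exists2 j, [/\ (j \in [:: 3; 6; 9])%N, (i = j) \/ (i = partner j) & s = s'] & seg j (arm_pt i s s').
Proof.
move=> i9 [s0 sl ss].
have R1 : s' = len i -> ray i (arm_pt i s s').
  move=> e; apply/(rayP _ i9); exists (s - len i); first by rewrite subr_ge0 -e.
  by rewrite /arm_pt /foot e; apply: pair_ext; rewrite !coordE; ring.
case=> [e|/R1]; last by left.
have [pi|/eqP pi] := eqVneq (partner i) i.
  left; apply: R1; apply/le_anti; rewrite sl /=.
  by have [_] := len_ge0 i9; rewrite pi eqxx => /eqP <-.
right; have [j jS ij] := double_index_corner i9 pi; exists j => //; apply/(segP _ jS).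
have j9 := corner_range jS; exists s'.
  by rewrite s0 /=; case: ij sl => -> //; rewrite len_partner.
rewrite /arm_pt e; case: ij => ->; rewrite ?vtx_partner ?partnerK //;
  by apply: pair_ext; rewrite !coordE; ring.
Qed.

(** The first coordinate is the lattice length of the path, because the
    directions of the segments and of the rays are primitive. *)
Lemma path_arm W h t : path_to_hexagon nu C W h t ->
  [/\ hexagon nu C W, h = W & t = 0] \/
  exists i s', [/\ (1 <= i <= 9)%N, h = vtx i, arm i t s' & W = arm_pt i t s'].
Proof.
move=> [hh []]; first by case=> <- ->; left.
  case=> E [/outer_edge_cases[[i i9 ->]|[j jS ->]]].
    move=> hE WE L; right; have [pi eh] := hexagon_ray i9 hh hE.
    have /(rayP _ i9)[s s0 eW] := WE; have l0 : len i = 0.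
      by have [_] := len_ge0 i9; rewrite pi eqxx => /eqP <-.
    have ft := foot_single i9 pi.
    exists i, 0; move: L; rewrite eW ft eh => /(lattice_length_unique (dir_primitive i) s0) ->.
    split=> //; last by rewrite /arm_pt scale0r addr0.
    by split; rewrite ?l0 ?lexx //; right.
  move=> hE WE L; right; have eh := hexagon_seg jS hh hE.
  have /(segP _ jS)[s /andP[s0 sl] eW] := WE.
  move: L; rewrite eW eh => /(lattice_length_unique (spine_primitive jS) s0) ->.
  exists j, s; split; rewrite ?corner_range //; first by split => //; left.
  by rewrite /arm_pt; apply: pair_ext; rewrite !coordE; ring.
move=> [B [E [b [t1 [t2 [[/is_segmentP[j jS ->] /is_rayP[i i9 ->]] Bh [Bb Eb] EW [L1 L2 ->]]]]]]].
right; have [/orP ij eb] := ray_seg i9 jS Eb Bb.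
have eh := hexagon_seg jS hh Bh; have j9 := corner_range jS.
have [ev [el ed]] : vtx j = vtx i /\ len j = len i /\ dir j + dir (partner j) = dir i + dir (partner i).
  case: ij => /eqP ->; first by [].
  by rewrite vtx_partner // len_partner // partnerK // addrC.
have L0 : 0 <= len i by have [] := len_ge0 i9.
move: L1; rewrite eh eb ev /foot -ed -el => /(lattice_length_unique (spine_primitive jS)).
rewrite el => /(_ L0) ->.
have /(rayP _ i9)[s s0 eW] := EW.
move: L2; rewrite eW eb => /(lattice_length_unique (dir_primitive i) s0) ->.
exists i, (len i); split => //; first by split; rewrite ?lexx ?lerDl //; right.
by rewrite /arm_pt /foot; apply: pair_ext; rewrite !coordE; ring.
Qed.

(** An end of the edge dual to the ray [i] that is not a corner; it is minimal
    on the ray [i] and also on the segment before it. *)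
Definition inner i := nth center
  [:: center; walk 1; walk 1; walk 2; walk 4; walk 4; walk 5; walk 7; walk 7; walk 8] i.

Lemma inner_monomial i : (1 <= i <= 9)%N -> (inner i \in monomials) * (inner i != center).
Proof. by move: i; apply: index_cases; do 2!split. Qed.

Lemma ray_inner i W : (1 <= i <= 9)%N -> ray i W -> tmin nu C W (inner i).
Proof.
move=> + []; move: i; apply: index_cases; split; split => //.
Qed.

Lemma seg_inner j W : (j \in [:: 3; 6; 9])%N -> seg j W ->
  tmin nu C W (inner j) /\ tmin nu C W (inner (partner j)).
Proof. by move=> + []; move: j; apply: corner_cases. Qed.

Lemma arm_inner i s s' : (1 <= i <= 9)%N -> arm i s s' -> tmin nu C (arm_pt i s s') (inner i).
Proof.
move=> i9 /(arm_outer i9)[/(ray_inner i9)//|[j [jS ij _] /(seg_inner jS)[a b]]].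
by case: ij => e; rewrite [in inner _]e.
Qed.

Lemma arm_single i s s' : (1 <= i <= 9)%N -> arm i s s' -> partner i = i -> s' = 0.
Proof.
move=> i9 [s'0 s'l _ _] pi; apply/le_anti; rewrite s'0 andbT (le_trans s'l) //.
by have [_] := len_ge0 i9; rewrite pi eqxx => /eqP <-.
Qed.

(** This makes the length of a path to the hexagon intrinsic: it is the amount
    by which the central monomial exceeds the minimum. *)
Lemma arm_gap i s s' : (1 <= i <= 9)%N -> arm i s s' ->
  tropval (arm_pt i s s') center - tropval (arm_pt i s s') (inner i) = s.
Proof.
move=> i9 /(arm_single i9); move: i i9.
apply: index_cases; split; split => e.
all: try rewrite (e erefl); rewrite /tropval /arm_pt !coordE.
all: rewrite /vtx /dir /=; gen_heights => *; try ring.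
Qed.

Lemma tmin_eq W m m' : tmin nu C W m -> tmin nu C W m' -> tropval W m = tropval W m'.
Proof.
move=> mW m'W; apply/le_anti.
by rewrite (tmin_mono mW m'W.1) (tmin_mono m'W mW.1).
Qed.

Lemma path_length W h t m : path_to_hexagon nu C W h t -> tmin nu C W m ->
  t = tropval W center - tropval W m.
Proof.
move=> /path_arm[[hW _ ->] mW|[i [s' [i9 _ a ->]] mW]].
  by rewrite (tmin_eq (hexagon_tmin hW) mW) subrr.
by rewrite -(tmin_eq (arm_inner i9 a) mW) (arm_gap i9 a).
Qed.

Lemma arm0 i : (1 <= i <= 9)%N -> arm i 0 0 /\ arm_pt i 0 0 = vtx i.
Proof.
move=> i9; split; last by rewrite /arm_pt !scale0r !addr0.
by split; rewrite ?lexx //; [have [-> _] := len_ge0 i9|left].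
Qed.

Lemma vtx_center i : (1 <= i <= 9)%N -> tmin nu C (vtx i) center.
Proof.
move=> i9; have [a <-] := arm0 i9; have := arm_inner i9 a.
have /eqP := arm_gap i9 a; rewrite subr_eq0 => /eqP e.
case/tmin_height => _ H.
by apply/tmin_height; split => //; rewrite e.
Qed.

Lemma tmin_hexagon W m : m != center -> tmin nu C W center -> tmin nu C W m -> hexagon nu C W.
Proof. by move=> mc cW mW; exists m. Qed.

Lemma hexagon_vtx i : (1 <= i <= 9)%N -> hexagon nu C (vtx i).
Proof.
move=> i9; apply: tmin_hexagon (vtx_center i9) _; first exact: (inner_monomial i9).2.
by have [a <-] := arm0 i9; exact: arm_inner.
Qed.

Lemma outer_hex_vertex E P : outer_edge nu C E -> E P -> hexagon nu C P -> hex_vertex nu C P.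
Proof.
move=> [m [m' [mc m'c mm' -> _]]] [mP m'P] /hexagon_tmin cP.
by exists m, m'; split.
Qed.

Lemma hex_vertexP P : hex_vertex nu C P <-> exists2 i, (1 <= i <= 9)%N & P = vtx i.
Proof.
split=> [[m [m' [mc m'c mm' [cP mP] [_ m'P]]]]|[i i9 ->]].
  have hP : hexagon nu C P by exists m.
  have /outer_edge_cases[[i i9 e]|[j jS e]] : outer_edge nu C (cell nu C m m').
    by exists m, m'; split => //; exists P.
    by have [_ ->] : partner i = i /\ P = vtx i; [apply: hexagon_ray; rewrite -?e|exists i].
  have -> : P = vtx j by apply: hexagon_seg; rewrite -?e.
  by exists j => //; exact: corner_range.
have [a e] := arm0 i9; have := arm_outer i9 a; rewrite e => -[r|[j [jS _ _] r]].
  by apply: (outer_hex_vertex _ r); [exact: outer_ray|exact: hexagon_vtx].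
by apply: (outer_hex_vertex _ r); [exact: outer_seg|exact: hexagon_vtx].
Qed.

Lemma path_exists i s s' : (1 <= i <= 9)%N -> arm i s s' ->
  path_to_hexagon nu C (arm_pt i s s') (vtx i) s.
Proof.
move=> i9 a; split; first exact: hexagon_vtx.
have s0 : 0 <= s by case: a => ? _ ? _; apply: le_trans; eassumption.
have [pi|/eqP pi] := eqVneq (partner i) i.
  have l0 : len i = 0 by have [_] := len_ge0 i9; rewrite pi eqxx => /eqP <-.
  have s'0 := arm_single i9 a pi.
  have e : arm_pt i s s' = vtx i + s *: dir i by rewrite /arm_pt s'0 scale0r addr0.
  have ft := foot_single i9 pi.
  apply: Or32; exists (ray i); split.
  - exact: outer_ray.
  - by rewrite -ft; exact: ray_foot.
  - by apply/(rayP _ i9); exists s => //; rewrite ft.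
  - by rewrite e; apply: lattice_lengthP => //; exact: dir_primitive.
have [j jS ij] := double_index_corner i9 pi; have j9 := corner_range jS.
have [ev [el ed]] : vtx j = vtx i /\ len j = len i /\ dir j + dir (partner j) = dir i + dir (partner i).
  case: ij => ->; first by [].
  by rewrite vtx_partner // len_partner // partnerK // addrC.
have pl : lattice_length (vtx i) (foot i) (len i).
  rewrite /foot -ed; apply: lattice_lengthP; first exact: spine_primitive.
  by have [] := len_ge0 i9.
case: a => s'0 s'l ss [e|e].
  apply: Or32; exists (seg j); split.
  - exact: outer_seg.
  - by rewrite -ev; exact: seg_vtx.
  - apply/(segP _ jS); exists s; first by rewrite s0 el e.
    by rewrite /arm_pt ev ed -e; apply: pair_ext; rewrite !coordE; ring.
  - have -> : arm_pt i s s' = vtx i + s *: (dir j + dir (partner j)).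
      by rewrite /arm_pt ed -e; apply: pair_ext; rewrite !coordE; ring.
    by apply: lattice_lengthP => //; exact: spine_primitive.
have e2 : arm_pt i s s' = foot i + (s - len i) *: dir i.
  by rewrite /arm_pt /foot e; apply: pair_ext; rewrite !coordE; ring.
have s1 : 0 <= s - len i by rewrite subr_ge0 -e.
apply: Or33; exists (seg j), (ray i), (foot i), (len i), (s - len i); split.
- by split; [apply/is_segmentP; exists j|apply/is_rayP; exists i].
- by rewrite -ev; exact: seg_vtx.
- split; last exact: ray_foot.
  have -> : foot i = foot j by case: ij => ->; rewrite ?foot_partner.
  exact: seg_foot.
- by apply/(rayP _ i9); exists (s - len i).
- split => //; last by rewrite addrC subrK.
  by rewrite e2; apply: lattice_lengthP => //; exact: dir_primitive.
Qed.

Lemma hex_distance_arm i s s' : (1 <= i <= 9)%N -> arm i s s' ->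
  hex_distance nu C (arm_pt i s s') = s.
Proof.
move=> i9 a; have p := path_exists i9 a; rewrite /hex_distance.
case: xgetP => [t -> [h q]|/(_ s)[]]; last by exists (vtx i).
by rewrite (path_length q (arm_inner i9 a)) (arm_gap i9 a).
Qed.

(** The retraction is defined to be the point itself if it has no path to the
    hexagon, but a point of the hexagon has one. *)
Lemma path_exists_retraction W : hexagon nu C (retraction nu C W) ->
  exists t, path_to_hexagon nu C W (retraction nu C W) t.
Proof.
rewrite /retraction; case: xgetP => // no hW.
by case: (no W); exists 0; split => //; exact: Or31.
Qed.

(** Two coinciding vertices would contradict strict convexity. *)
Lemma vtx_inj i k : (1 <= i <= 9)%N -> (1 <= k <= 9)%N -> vtx i = vtx k ->
  k = i \/ k = partner i.
Proof.
move=> i9 k9 /coord_eq e.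
suff /orP[/eqP->|/eqP->] : (k == i) || (k == partner i) by [left|right|].
move: e; move: k k9; apply: index_cases; move: i i9; apply: index_cases;
  (do 4!split); rewrite /vtx /=; try (move=> _; exact: isT).
all: move: height_ineqs; gen_heights => *; exfalso; split_ands.
all: lra.
Qed.

(** A linear form that grows along the rays of the direction [dir i] and
    along no other ray. *)
Definition axial i (P : R * R) : R :=
  if (i <= 3)%N then P.1 else if (i <= 6)%N then P.2 else - P.1.

Lemma axial_dir i k : dir k = dir i \/ axial i (dir k) <= 0.
Proof.
rewrite /axial /dir; case: (k <= 3)%N; case: (i <= 3)%N; case: (k <= 6)%N; case: (i <= 6)%N;
  by [left | right; rewrite /=; lra].
Qed.

Lemma axial_arm i k s s' :
  axial i (arm_pt k s s') = axial i (vtx k) + s * axial i (dir k) + s' * axial i (dir (partner k)).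
Proof.
by rewrite /axial /arm_pt; case: ifP => _; last case: ifP => _; rewrite !coordE //; ring.
Qed.

Lemma hexagon_axial i W : hexagon nu C W -> exists2 k, (1 <= k <= 9)%N & axial i W <= axial i (vtx k).
Proof.
move=> /hexagon_tmin/tmin_le H.
exists (if (i <= 3)%N then 2 else if (i <= 6)%N then 5 else 8)%N; first by case: ifP => // _; case: ifP.
move: H; rewrite /axial /vtx /tropval; case: ifP => _; last case: ifP => _; rewrite /=;
  gen_heights => *; split_ands; lra.
Qed.

(** A point farther out than the hexagon along one of the three axes must have
    travelled along a ray of that axis. *)
Lemma path_far i W h t : path_to_hexagon nu C W h t ->
  (forall k, (1 <= k <= 9)%N -> axial i (vtx k) < axial i W) ->
  exists k, [/\ (1 <= k <= 9)%N, h = vtx k & dir k = dir i].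
Proof.
move=> /path_arm[[hW _ _]|[k [s' [k9 -> [s'0 _ s's _] ->]]]] far.
  by have [k k9] := hexagon_axial i hW; rewrite leNgt far.
have [kd|kd] := axial_dir i k; first by exists k.
have [pd|pd] := axial_dir i (partner k).
  by exists (partner k); rewrite vtx_partner ?partner_range.
have := far _ k9; rewrite axial_arm -addrA ltrDl ltNge => /negP[].
by rewrite -[0]addr0 lerD // mulr_ge0_le0 // (le_trans s'0).
Qed.

(** The dual edges of two rays that meet are compatible, which leaves only
    the two rays at the end of one segment. *)
Lemma ray_ray i k W : (1 <= i <= 9)%N -> (1 <= k <= 9)%N -> ray i W -> ray k W ->
  i = k \/ W = foot k.
Proof.
move=> i9 k9 ri rk; have [/andP[i1 i2] /andP[k1 k2]] := (ray_outer i9, ray_outer k9).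
have /orP[/eqP ->|/eqP ki] : (k == i) || (k == partner i); [|by left|].
  have := And4 (cell_compatible i1 k1 ri.1 rk.1) (cell_compatible i1 k2 ri.1 rk.2)
               (cell_compatible i2 k1 ri.2 rk.1) (cell_compatible i2 k2 ri.2 rk.2).
  move: k k9 {ri rk i1 i2 k1 k2}; apply: index_cases; do 2!split;
    by move: i i9; apply: index_cases; split; split; case.
have [pi|/eqP pi] := eqVneq (partner i) i; first by left; rewrite ki pi.
right; move/(rayP _ i9): ri => [t t0 Wi]; move/(rayP _ k9): rk => [s s0 Wk].
suff s00 : s = 0 by rewrite Wk s00 scale0r addr0.
move: Wi; rewrite Wk ki foot_partner // => /addrI /coord_eq; rewrite !coordE.
move: i i9 pi {i1 i2 ki Wk}; apply: index_cases; do 2!split; rewrite /partner /dir //= => _ [? ?]; lra.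
Qed.

Lemma arm_pt_inj i s s' r r' : (1 <= i <= 9)%N -> (partner i = i -> s' = r') ->
  arm_pt i s s' = arm_pt i r r' -> s = r /\ s' = r'.
Proof.
move=> + + /coord_eq; rewrite /arm_pt !coordE; case: (vtx i) => x y.
move: i; apply: index_cases; (do 2!split); rewrite /dir /= => e.
all: try (have -> := e erefl).
all: move=> -[]; lra.
Qed.

(** The directions of partners are linearly independent, so that the
    coordinates of a point behind [vtx i] can be read off any representation. *)
Lemma arm_of_path i s s' t : (1 <= i <= 9)%N -> (partner i = i -> s' = 0) ->
  path_to_hexagon nu C (arm_pt i s s') (vtx i) t -> arm i s s' \/ arm (partner i) s' s.
Proof.
move=> i9 ps /path_arm[[_ e _]|[k [r' [k9 ev a e]]]].
  have [a0 e0] := arm0 i9; move: e; rewrite -e0 => /esym /(arm_pt_inj i9) [//|-> ->].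
  by left.
have [ki|ki] := vtx_inj i9 k9 ev; subst k.
  have [|-> ->] := arm_pt_inj i9 _ e; last by left.
  by move=> pi; rewrite ps // (arm_single i9 a).
have e' : arm_pt i s s' = arm_pt i r' t.
  by rewrite e /arm_pt partnerK // vtx_partner // addrAC.
have [pi|/eqP pi] := eqVneq (partner i) i; last first.
  by have [|-> ->] := arm_pt_inj i9 _ e'; last by right.
move: a e; rewrite pi => a e; have [|-> ->] := arm_pt_inj i9 _ e; last by left.
by move=> _; rewrite ps // (arm_single i9 a).
Qed.

Lemma ray_arm i W : (1 <= i <= 9)%N -> ray i W ->
  exists2 s, arm i s (len i) & W = arm_pt i s (len i).
Proof.
move=> i9 /(rayP _ i9)[t t0 ->]; exists (len i + t).
  by split; rewrite ?lerDl //; [have [] := len_ge0 i9|right].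
by rewrite /arm_pt /foot; apply: pair_ext; rewrite !coordE; ring.
Qed.

Lemma arm_ray i s : (1 <= i <= 9)%N -> arm i s (len i) -> ray i (arm_pt i s (len i)).
Proof.
move=> i9 [_ _ ls _]; apply/(rayP _ i9); exists (s - len i); first by rewrite subr_ge0.
by rewrite /arm_pt /foot; apply: pair_ext; rewrite !coordE; ring.
Qed.

(** Index of the corner in front of the ray [i]: the segment behind [vtx i] is
    [seg (corner i)]. *)
Definition corner i := if (i \in [:: 3; 6; 9])%N then i else partner i.

Lemma cornerP i : (1 <= i <= 9)%N -> partner i <> i ->
  [/\ (corner i \in [:: 3; 6; 9])%N, vtx (corner i) = vtx i, len (corner i) = len i &
      dir (corner i) + dir (partner (corner i)) = dir i + dir (partner i)].
Proof.
move=> i9 pi; have [j jS [ij|ij]] := double_index_corner i9 pi; rewrite /corner ij.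
  by rewrite jS.
have -> : (partner j \in [:: 3; 6; 9]%N) = false by move: j jS {ij}; apply: corner_cases.
have j9 := corner_range jS; rewrite partnerK // jS; split => //.
- by rewrite vtx_partner.
- by rewrite len_partner.
- by rewrite addrC.
Qed.

Lemma seg_arm i W : (1 <= i <= 9)%N -> partner i <> i -> seg (corner i) W <->
  exists2 s, arm i s s & W = arm_pt i s s.
Proof.
move=> i9 pi; have [jS ev el ed] := cornerP i9 pi; rewrite (segP _ jS) ev el ed.
split=> -[s].
  move=> /andP[s0 sl] ->; exists s; first by split => //; left.
  by rewrite /arm_pt; apply: pair_ext; rewrite !coordE; ring.
move=> [s0 sl _ _] ->; exists s; first by rewrite s0.
by rewrite /arm_pt; apply: pair_ext; rewrite !coordE; ring.
Qed.

Lemma vertex_with_rayP P E : vertex_with_ray nu C P E <->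
  exists i, [/\ (1 <= i <= 9)%N, partner i = i, P = vtx i & E = ray i].
Proof.
split=> [[/hex_vertexP[k k9 Pk] /is_rayP[i i9 ->] iP _]|[i [i9 pi -> ->]]].
  have [pi eP] := hexagon_ray i9 (eq_ind_r (hexagon nu C) (hexagon_vtx k9) Pk) iP.
  by exists i.
have ft := foot_single i9 pi.
split; first by apply/hex_vertexP; exists i.
- by apply/is_rayP; exists i.
- by rewrite -ft; exact: ray_foot.
- move=> E' /is_rayP[k k9 ->] /(hexagon_ray k9 (hexagon_vtx i9))[pk /(vtx_inj i9 k9)[->//|->]].
  by rewrite pi.
Qed.

Lemma vertex_with_segmentP P B E E' : vertex_with_segment nu C P B E E' <->
  exists i, [/\ (1 <= i <= 9)%N, partner i <> i, P = vtx i, B = seg (corner i) &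
                E = ray i /\ E' = ray (partner i)].
Proof.
split=> [[/hex_vertexP[k k9 Pk] /is_segmentP[j jS ->] jP]|].
  move=> [[/is_rayP[i i9 ->] /is_rayP[i' i'9 ->]] ne [b [bP Bb Eb E'b]]].
  have eP := hexagon_seg jS (eq_ind_r (hexagon nu C) (hexagon_vtx k9) Pk) jP.
  have j9 := corner_range jS; have pj := partner_corner jS.
  have [/orP[]/eqP ij _] := ray_seg i9 jS Eb Bb; have [/orP[]/eqP i'j _] := ray_seg i'9 jS E'b Bb.
  - by case: ne; rewrite ij i'j.
  - by exists j; rewrite /corner jS ij i'j.
  - exists (partner j); rewrite partnerK //; split; rewrite ?partner_range ?vtx_partner //.
    + by move/esym.
    + rewrite /corner; have -> : (partner j \in [:: 3; 6; 9]%N) = false.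
        by move: (j) jS; apply: corner_cases.
      by rewrite partnerK.
    + by rewrite ij i'j.
  - by case: ne; rewrite ij i'j.
move=> [i [i9 pi -> -> [-> ->]]]; have [jS ev el ed] := cornerP i9 pi.
split.
- by apply/hex_vertexP; exists i.
- by apply/is_segmentP; exists (corner i).
- by rewrite -ev; exact: seg_vtx.
- split; first by split; apply/is_rayP; [exists i|exists (partner i); rewrite ?partner_range].
  have [t t0 ft] := norm_dir_gt i (foot i) `|foot i|.
  have Wi : ray i (foot i + t *: dir i) by apply/(rayP _ i9); exists t.
  move=> e; have Wp : ray (partner i) (foot i + t *: dir i) by rewrite -e.
  have [/esym//|] := ray_ray i9 (partner_range i9) Wi Wp.
  by rewrite foot_partner // => eW; move: ft; rewrite eW ltxx.
- exists (foot i); split.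
  + move=> e; have : hexagon nu C (foot i) by rewrite e; exact: hexagon_vtx.
    by move=> /(hexagon_ray i9)/(_ (ray_foot i9))[/pi].
  + have -> : foot i = foot (corner i); last exact: seg_foot.
    by rewrite /corner; case: ifP => // _; rewrite foot_partner.
  + exact: ray_foot.
  + by rewrite -foot_partner //; apply: ray_foot; rewrite partner_range.
Qed.

End Honeycomb.

(** * The excess of theta at a zero *)

Section Excess.
Context (R : realType) (K : fieldType) (nu : valuation R K).
Hypothesis Kcomplete : vcomplete nu.
Context (q : K).
Hypotheses (q0 : q != 0) (qpos : (0 < nu q)%E).
Local Notation Q := (rval nu q).
Let Q0 : 0 < Q := rval_q_gt0 q0 qpos.

(** Equality in the circle of real numbers modulo [val q]. *)
Definition same_class x y := exists n : int, rval nu x + n%:~R * Q = rval nu y.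

(** The contribution of the zero [y] to the valuation of [Theta (x / y)] beyond
    the piecewise linear part. *)
Definition excess x y : \bar R := if `[< same_class x y >] then delta nu q x y else 0%E.

Lemma deltaE x y (n : int) : x != 0 -> y != 0 -> rval nu x + n%:~R * Q = rval nu y ->
  delta nu q x y = nu (1 - x / y * q ^ n).
Proof.
move=> x0 y0 xy; rewrite /delta.
suff -> : xget 0 [set i : int | (nu x + nu (q ^ i)%R)%E = nu y] = n by [].
have E i : (nu x + nu (q ^ i)%R)%E = nu y <-> rval nu x + i%:~R * Q = rval nu y.
  rewrite !vfunE ?expfz_neq0 // rval_exprz // -EFinD.
  by split=> [[]|->].
case: xgetP => [i -> /E|/(_ n)/E//]; rewrite -xy => /addrI /(mulIf (lt0r_neq0 Q0)) /eqP.
by rewrite eqr_int => /eqP.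
Qed.

Lemma excess_ge0 x y : x != 0 -> y != 0 -> (0 <= excess x y)%E.
Proof.
move=> x0 y0; rewrite /excess; case: asboolP => // -[n xy]; rewrite (deltaE x0 y0 xy).
apply: vfun_1B_ge0; rewrite vfunE ?mulf_neq0 ?invr_neq0 ?expfz_neq0 // lee_fin.
by rewrite rvalM ?mulf_neq0 ?invr_neq0 ?expfz_neq0 // rval_div // rval_exprz // -xy; lra.
Qed.

Lemma excess_pinfty x y : x != 0 -> y != 0 -> excess x y = +oo%E <-> qZ q (x / y).
Proof.
move=> x0 y0; rewrite /excess; split.
  case: asboolP => // -[n xy]; rewrite (deltaE x0 y0 xy) => /(vfun_pinfty nu) /eqP.
  rewrite subr_eq0 => /eqP e; exists (- n).
  by rewrite -invr_expz -[LHS](mulfK (expfz_neq0 n q0)) -e mul1r.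
move=> [n xy]; have e : rval nu x + (- n)%:~R * Q = rval nu y.
  by rewrite -(divfK y0 x) xy rvalM ?expfz_neq0 // rval_exprz // mulrNz; lra.
case: asboolP => [_|[]]; last by exists (- n).
by rewrite (deltaE x0 y0 e) xy -expfzDr // subrr expr0z subrr vfun0.
Qed.

Lemma excess_fin x y : x != 0 -> y != 0 -> ~ qZ q (x / y) -> excess x y \is a fin_num.
Proof.
move=> x0 y0 xy; have := excess_ge0 x0 y0; have := excess_pinfty x0 y0.
by case: (excess x y) => // -[H _] _; case: xy; exact: H.
Qed.

Lemma vfun_Theta_quot x y N : x != 0 -> y != 0 -> `|rval nu x - rval nu y| < N%:R * Q ->
  nu (Theta nu q (x / y)) = ((ptheta nu q N (rval nu x - rval nu y))%:E + excess x y)%E.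
Proof.
move=> x0 y0; rewrite -rval_div // => xyN; rewrite /excess.
have xy0 : x / y != 0 by rewrite mulf_neq0 ?invr_neq0.
case: asboolP => [[n xy]|nxy].
  by rewrite (deltaE x0 y0 xy) (Theta_special Kcomplete q0 qpos xy0 xyN (n := n)) // rval_div //; lra.
rewrite adde0 (Theta_generic Kcomplete q0 qpos xy0 xyN) // => n; rewrite rval_div // => e.
by apply: nxy; exists n; lra.
Qed.

Lemma excess_near x y : y != 0 -> x != y -> (nu y < nu (x - y)%R)%E ->
  [/\ x != 0, rval nu x = rval nu y & excess x y = (rval nu (x - y) - rval nu y)%:E].
Proof.
move=> y0 xy lt; have xE : nu x = nu y by rewrite -(vfunD_lt lt) addrC subrK.
have x0 : x != 0 by apply/eqP => x0; move: xE; rewrite x0 vfun0 vfunE.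
have rE : rval nu x = rval nu y by rewrite /rval xE.
have e : rval nu x + 0%:~R * Q = rval nu y by rewrite mul0r addr0.
split=> //; rewrite /excess asboolT; last by exists 0.
rewrite (deltaE x0 y0 e) expr0z mulr1.
have -> : 1 - x / y = - ((x - y) / y) by rewrite mulrBl divff // opprB.
by rewrite vfunN vfunE ?mulf_neq0 ?invr_neq0 ?subr_eq0 // rval_div ?subr_eq0.
Qed.

(** By the ultrametric inequality the excess at [w] is locally constant away
    from [w]. *)
Lemma excess_near_other x y w : y != 0 -> w != 0 -> x != y -> ~ qZ q (y / w) ->
  ((rval nu y + fine (excess y w))%:E < nu (x - y)%R)%E -> excess x w = excess y w.
Proof.
move=> y0 w0 xy yw; rewrite vfunE ?subr_eq0 // lte_fin => lt.
have ge := excess_ge0 y0 w0; have fin := excess_fin y0 w0 yw.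
have ge' : 0 <= fine (excess y w) by rewrite fine_ge0.
have ltx : (nu y < nu (x - y)%R)%E by rewrite (vfunE nu y0) vfunE ?subr_eq0 // lte_fin; lra.
have [x0 xE _] := excess_near y0 xy ltx.
move: fin ge ge' lt; rewrite /excess /same_class xE; case: asboolP => // -[n yn] fin ge ge' lt.
have xn : rval nu x + n%:~R * Q = rval nu w by rewrite xE.
move: fin ge ge' lt; rewrite (deltaE x0 w0 xn) (deltaE y0 w0 yn) => fin ge ge' lt.
have -> : 1 - x / w * q ^ n = (1 - y / w * q ^ n) - (x - y) / w * q ^ n by ring.
have r0 : (x - y) / w * q ^ n != 0 by rewrite !mulf_neq0 ?invr_neq0 ?expfz_neq0 ?subr_eq0.
rewrite vfunB_lt // (vfunE nu r0) -(fineK fin) lte_fin.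
rewrite rvalM ?mulf_neq0 ?invr_neq0 ?expfz_neq0 ?subr_eq0 //.
by rewrite rval_div ?subr_eq0 // rval_exprz // -yn; lra.
Qed.

Lemma approach_exists y (M : R) : y != 0 -> exists2 x, x != y & (M%:E <= nu (x - y)%R)%E.
Proof.
move=> y0; pose n := (Num.truncn (`|M| / Q)).+1; exists (y + q ^+ n).
  by rewrite -subr_eq0 addrAC subrr add0r expf_neq0.
rewrite addrAC subrr add0r vfunE ?expf_neq0 // lee_fin rvalX //.
have : `|M| / Q < n%:R by exact: truncnS_gt.
by rewrite ltr_pdivrMr // => lt; have := ler_norm M; lra.
Qed.

End Excess.

(** * Valuations of the honeycomb embedding *)

Section Embedding.
Context (R : realType) (K : closedFieldType) (nu : valuation R K).
Context (q a b c : K) (p : nat -> K) (C : nat -> nat -> nat -> K).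
Hypothesis Kcomplete : vcomplete nu.
Hypotheses (q0 : q != 0) (qpos : (0 < nu q)%E).
Hypothesis psi_emb : honeycomb_embedding nu q a b c p C.
Local Notation Q := (rval nu q).
Local Notation psi := (psi nu q a b c p).
Local Notation trop_psi := (trop_psi nu q a b c p).
Local Notation exc z i := (excess nu q z (p i)).

Definition theta_at N i s : R := ptheta nu q N (s - rval nu (p i)).

(** The position of [trop (psi x)] for [val x = s] if all excesses vanish. *)
Definition generic_trop N (s : R) : R * R :=
  (rval nu a + theta_at N 1 s + theta_at N 2 s + theta_at N 3 s
     - (rval nu c + theta_at N 7 s + theta_at N 8 s + theta_at N 9 s),
   rval nu b + theta_at N 4 s + theta_at N 5 s + theta_at N 6 s
     - (rval nu c + theta_at N 7 s + theta_at N 8 s + theta_at N 9 s)).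

Definition in_range N (s : R) :=
  forall i, (1 <= i <= 9)%N -> `|s - rval nu (p i)| < N%:R * Q.

Definition excess_vector z : R * R := \sum_(1 <= i < 10) fine (exc z i) *: dir R i.

Lemma p_neq0 i : (1 <= i <= 9)%N -> p i != 0.
Proof. exact: (he_p0 psi_emb). Qed.

Lemma in_range_exists s : exists N, in_range N s.
Proof.
have Q0 : 0 < Q := rval_q_gt0 q0 qpos.
pose S := \sum_(1 <= i < 10) `|s - rval nu (p i)|; exists (Num.truncn (S / Q)).+1 => i /andP[i1 i9].
have SQ : S < (Num.truncn (S / Q)).+1%:R * Q by rewrite -ltr_pdivrMr // truncnS_gt.
apply: le_lt_trans SQ; rewrite /S (bigD1_seq i) ?iota_uniq ?mem_index_iota ?i1 //=.
by rewrite lerDl sumr_ge0.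
Qed.

Lemma exc_ge0 z i : (1 <= i <= 9)%N -> z != 0 -> (0 <= exc z i)%E.
Proof. by move=> /p_neq0 pi z0; exact: excess_ge0. Qed.

Lemma vfun_theta N z i : (1 <= i <= 9)%N -> z != 0 -> in_range N (rval nu z) ->
  nu (Theta nu q (z / p i)) = ((theta_at N i (rval nu z))%:E + exc z i)%E.
Proof. by move=> i9 z0 /(_ i i9) zN; apply: vfun_Theta_quot => //; exact: p_neq0. Qed.

Lemma vfun_psi N z : z != 0 -> in_range N (rval nu z) -> let T i := theta_at N i (rval nu z) in
  [/\ nu (psi z).1.1 = ((rval nu a + T 1 + T 2 + T 3)%:E + (exc z 1 + exc z 2 + exc z 3))%E,
      nu (psi z).1.2 = ((rval nu b + T 4 + T 5 + T 6)%:E + (exc z 4 + exc z 5 + exc z 6))%E &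
      nu (psi z).2 = ((rval nu c + T 7 + T 8 + T 9)%:E + (exc z 7 + exc z 8 + exc z 9))%E]%N.
Proof.
move=> z0 zN T; have [a0 b0 c0] := he_abc psi_emb.
have E (d : K) (t1 t2 t3 : R) (x1 x2 x3 : \bar R) : d != 0 ->
    (nu d + (t1%:E + x1 + (t2%:E + x2) + (t3%:E + x3)) =
     (rval nu d + t1 + t2 + t3)%:E + (x1 + x2 + x3))%E.
  move=> d0; rewrite (vfunE nu d0) [(t1%:E + x1 + (t2%:E + x2))%E]addeACA.
  rewrite [(t1%:E + t2%:E + (x1 + x2) + (t3%:E + x3))%E]addeACA addeA.
  by rewrite -!EFinD !addrA -EFinD !addrA.
by split; rewrite /Defs.psi /= 3!vfunM !(@vfun_theta N) // E.
Qed.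

Lemma index_all (P : nat -> Prop) :
  (forall i, (1 <= i <= 9)%N -> P i) ->
  [/\ [/\ P 1, P 2 & P 3], [/\ P 4, P 5 & P 6] & [/\ P 7, P 8 & P 9]]%N.
Proof. by move=> H; do 2!split; apply: H. Qed.

Lemma off_axesP z : z != 0 ->
  off_axes (psi z) <-> forall i, (1 <= i <= 9)%N -> exc z i \is a fin_num.
Proof.
move=> z0; have [N zN] := in_range_exists (rval nu z); have [e1 e2 e3] := vfun_psi z0 zN.
have nz (x : K) : x != 0 <-> nu x \is a fin_num.
  split=> [|xf]; first exact: vfun_fin.
  by apply: contraTneq xf => ->; rewrite vfun0.
have fin3 (r : R) (x y w : \bar R) : (0 <= x)%E -> (0 <= y)%E -> (0 <= w)%E ->
    (r%:E + (x + y + w))%E \is a fin_num <-> [/\ x \is a fin_num, y \is a fin_num & w \is a fin_num].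
  move=> x0 y0 w0; rewrite fin_numD /= fin_numD fin_numD; split; last by case=> -> -> ->.
  by case/andP => /andP[-> ->] ->.
have ge := index_all (fun i i9 => exc_ge0 i9 z0).
case: ge => -[? ? ?] [? ? ?] [? ? ?].
rewrite /off_axes; split.
  case=> /nz + /nz + /nz; rewrite e1 e2 e3 => /fin3[] // ? ? ? /fin3[] // ? ? ? /fin3[] // ? ? ?.
  by apply: index_cases; do 2!split.
move=> /index_all [[? ? ?] [? ? ?] [? ? ?]].
by split; apply/nz; rewrite ?e1 ?e2 ?e3; apply/fin3.
Qed.

Lemma excess_vector_unfold z : let T i := fine (exc z i) *: dir R i in
  excess_vector z = T 1%N + (T 2%N + (T 3%N + (T 4%N + (T 5%N + (T 6%N + (T 7%N + (T 8%N + T 9%N))))))).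
Proof. by rewrite /excess_vector; do 9!rewrite big_ltn //; rewrite big_geq // addr0. Qed.

(** The homogeneous coordinates 1, 2 and 3 collect the excesses of three
    consecutive [p_i] each; after division by the third coordinate those of
    [p_7], [p_8], [p_9] count negatively in both affine coordinates, whence the
    direction [(-1, -1)]. *)
Lemma trop_psiE N z : z != 0 -> in_range N (rval nu z) -> off_axes (psi z) ->
  trop_psi z = generic_trop N (rval nu z) + excess_vector z.
Proof.
move=> z0 zN /(off_axesP z0)/index_all[[f1 f2 f3] [f4 f5 f6] [f7 f8 f9]].
have [e1 e2 e3] := vfun_psi z0 zN.
rewrite /Defs.trop_psi /trop /rval e1 e2 e3 excess_vector_unfold.
rewrite -(fineK f1) -(fineK f2) -(fineK f3) -(fineK f4) -(fineK f5) -(fineK f6).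
rewrite -(fineK f7) -(fineK f8) -(fineK f9) -!EFinD /=.
by apply: pair_ext; rewrite !coordE /generic_trop /dir /=; ring.
Qed.

Lemma psi_zero z : z != 0 ->
  [/\ (psi z).1.1 = 0 -> exists2 i, (1 <= i <= 3)%N & qZ q (z / p i),
      (psi z).1.2 = 0 -> exists2 i, (4 <= i <= 6)%N & qZ q (z / p i) &
      (psi z).2 = 0 -> exists2 i, (7 <= i <= 9)%N & qZ q (z / p i)].
Proof.
move=> z0; have [N zN] := in_range_exists (rval nu z); have [e1 e2 e3] := vfun_psi z0 zN.
have key (r : R) i j k : (1 <= i <= 9)%N -> (1 <= j <= 9)%N -> (1 <= k <= 9)%N ->
    (r%:E + (exc z i + exc z j + exc z k))%E = +oo%E ->
    [\/ qZ q (z / p i), qZ q (z / p j) | qZ q (z / p k)].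
  move=> i9 j9 k9 inf; apply: contrapT => no.
  have fin l : (1 <= l <= 9)%N -> ~ qZ q (z / p l) -> exc z l \is a fin_num.
    by move=> l9; apply: excess_fin => //; exact: p_neq0.
  have : (r%:E + (exc z i + exc z j + exc z k))%E \is a fin_num.
    by rewrite !fin_numD !fin // => ?; apply: no; [exact: Or33|exact: Or32|exact: Or31].
  by rewrite inf.
split=> /(vfun_pinfty nu); rewrite ?e1 ?e2 ?e3 => /key[] // H; eexists; try exact: H; by [].
Qed.

(** The three coordinates of [psi] have pairwise disjoint zeros, as
    [p_i / p_j] is never a power of [q]. *)
Lemma not_two_zeros z : z != 0 ->
  [/\ ~ ((psi z).1.1 = 0 /\ (psi z).1.2 = 0), ~ ((psi z).1.1 = 0 /\ (psi z).2 = 0)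
    & ~ ((psi z).1.2 = 0 /\ (psi z).2 = 0)].
Proof.
move=> z0; have [h1 h2 h3] := psi_zero z0.
have no i j : (1 <= i <= 9)%N -> (1 <= j <= 9)%N -> i <> j ->
    qZ q (z / p i) -> qZ q (z / p j) -> False.
  move=> i9 j9 ij [m em] [n en]; apply: (he_pq psi_emb i9 j9 ij); exists (n - m).
  rewrite expfzDr // -invr_expz -em -en invf_div.
  by have pj0 := p_neq0 j9; field; rewrite z0 pj0.
have rng (i l u : nat) : (l <= i <= u)%N -> (1 <= l)%N -> (u <= 9)%N -> (1 <= i <= 9)%N.
  by move=> /andP[li iu] l1 u9; rewrite (leq_trans l1 li) (leq_trans iu u9).
split=> -[].
- move=> /h1[i i9 zi] /h2[j j9 zj]; apply: (no _ _ (rng _ _ _ i9 isT isT) (rng _ _ _ j9 isT isT) _ zi zj).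
  by move=> e; move: i9 j9; rewrite e => /andP[_ le] /andP[/leq_trans/(_ le)].
- move=> /h1[i i9 zi] /h3[j j9 zj]; apply: (no _ _ (rng _ _ _ i9 isT isT) (rng _ _ _ j9 isT isT) _ zi zj).
  by move=> e; move: i9 j9; rewrite e => /andP[_ le] /andP[/leq_trans/(_ le)].
- move=> /h2[i i9 zi] /h3[j j9 zj]; apply: (no _ _ (rng _ _ _ i9 isT isT) (rng _ _ _ j9 isT isT) _ zi zj).
  by move=> e; move: i9 j9; rewrite e => /andP[_ le] /andP[/leq_trans/(_ le)].
Qed.

(** A vanishing corner coefficient would put a coordinate point on the cubic,
    and by surjectivity two coordinates of [psi] would vanish at one argument. *)
Lemma corner_neq0 : all (fun x => x != 0) [:: C 3 0 0; C 0 3 0; C 0 0 3].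
Proof.
rewrite /= andbT; apply/and3P; split; apply/eqP => C0.
- have : on_cubic C (1, 0, 0).
    by split; [apply/eqP => -[/eqP]; rewrite oner_eq0|rewrite /cubic_form C0; ring].
  case/(he_surj psi_emb) => z z0 [k k0 [_ e1 e2]].
  have [_ _] := not_two_zeros z0; apply.
  by split; apply: (mulfI k0); rewrite mulr0; apply/esym; [exact: e1|exact: e2].
- have : on_cubic C (0, 1, 0).
    by split; [apply/eqP => -[/eqP]; rewrite oner_eq0|rewrite /cubic_form C0; ring].
  case/(he_surj psi_emb) => z z0 [k k0 [e1 _ e2]].
  have [_ + _] := not_two_zeros z0; apply.
  by split; apply: (mulfI k0); rewrite mulr0; apply/esym; [exact: e1|exact: e2].
- have : on_cubic C (0, 0, 1).
    by split; [apply/eqP => -[/eqP]; rewrite oner_eq0|rewrite /cubic_form C0; ring].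
  case/(he_surj psi_emb) => z z0 [k k0 [e1 e2 _]].
  have [+ _ _] := not_two_zeros z0; apply.
  by split; apply: (mulfI k0); rewrite mulr0; apply/esym; [exact: e1|exact: e2].
Qed.

(** Close to [p_i] only the excess at [p_i] varies, and it is as large as
    desired. *)
Lemma near_p i (M : R) : (1 <= i <= 9)%N -> exists N : R, forall x, x != p i ->
  (N%:E <= nu (x - p i)%R)%E ->
  [/\ x != 0, rval nu x = rval nu (p i), off_axes (psi x), M <= fine (exc x i)
    & forall j, (1 <= j <= 9)%N -> j != i -> exc x j = exc (p i) j].
Proof.
move=> i9; have pi0 := p_neq0 i9.
pose S := \sum_(1 <= j < 10) `|fine (exc (p i) j)|.
have fS j : (1 <= j <= 9)%N -> fine (exc (p i) j) <= S.
  move=> j9; apply: le_trans (ler_norm _) _.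
  rewrite /S (bigD1_seq j) ?iota_uniq ?mem_index_iota //=.
  by rewrite lerDl sumr_ge0.
have S0 : 0 <= S by rewrite /S sumr_ge0.
exists (rval nu (p i) + S + `|M| + 1) => x xp le.
have xp0 : x - p i != 0 by rewrite subr_eq0.
have lt_of r : r <= S + `|M| -> ((rval nu (p i) + r)%:E < nu (x - p i)%R)%E.
  by move=> rS; apply: lt_le_trans le; rewrite lte_fin; lra.
have ltx : (nu (p i) < nu (x - p i)%R)%E.
  by rewrite (vfunE nu pi0) -[rval nu (p i)]addr0 lt_of // addr_ge0.
have [x0 xE ex] := excess_near q0 qpos pi0 xp ltx.
have other j : (1 <= j <= 9)%N -> j != i -> exc x j = exc (p i) j.
  move=> j9 ji; apply: (excess_near_other q0 qpos pi0 (p_neq0 j9) xp).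
    by apply: (he_pq psi_emb) => // /esym/eqP; apply/negP.
  by apply: lt_of; rewrite (le_trans (fS _ j9)) // lerDl.
split=> //; last first.
  rewrite ex /=; move: le; rewrite (vfunE nu xp0) lee_fin.
  by have := ler_norm M; lra.
apply/(off_axesP x0) => j j9; have [->|ji] := eqVneq j i; first by rewrite ex.
rewrite other //; apply: excess_fin => //; first exact: p_neq0.
by apply: (he_pq psi_emb) => // /esym/eqP; apply/negP.
Qed.

(** * Identification of the hexagon with the circle *)

Context (gamma : R -> R * R).
Hypothesis gamma_id : hexagon_identification nu q a b c p C gamma.
Local Notation vtx := (vtx nu C).
Local Notation dir := (dir R).
Local Notation arm_pt := (arm_pt nu C).
Local Notation arm := (arm nu C).
Local Notation is_lift := (is_lift nu q a b c p).
Local Notation towards := (towards nu q a b c p).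
Local Notation fiber := (TGL_fiber nu q a b c p).
Local Notation ray := (ray nu C).
Local Notation seg := (seg nu C).
Local Notation len := (len nu C).
Let C_form : honeycomb_form nu C := he_form psi_emb.
Let C_corner := corner_neq0.
Let Q0 : 0 < Q := rval_q_gt0 q0 qpos.

Lemma gamma_path z : z != 0 -> off_axes (psi z) ->
  exists t, path_to_hexagon nu C (trop_psi z) (gamma (rval nu z)) t.
Proof.
move=> z0 oz; have e := hi_retraction gamma_id z0 oz.
rewrite -e; apply: path_exists_retraction; rewrite e -(hi_onto gamma_id).
by exists (rval nu z).
Qed.

Lemma gamma_class x y : gamma (rval nu x) = gamma (rval nu y) <-> same_class nu q x y.
Proof.
rewrite hi_periodic //; last exact: gamma_id.
split=> -[n e]; exists (- n); rewrite mulrNz mulNr; [rewrite -e|rewrite -e]; lra.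
Qed.

Lemma excess_vector_split i z : (1 <= i <= 9)%N ->
  excess_vector z = fine (exc z i) *: dir i + \sum_(1 <= j < 10 | j != i) fine (exc z j) *: dir j.
Proof. by move=> i9; rewrite /excess_vector (bigD1_seq i) ?iota_uniq ?mem_index_iota. Qed.

Lemma axialD i (P P' : R * R) : axial i (P + P') = axial i P + axial i P'.
Proof. by rewrite /axial; case: ifP => _ //; case: ifP => _ //; rewrite coordE opprD. Qed.

Lemma axial_dir_self i t : axial i (t *: dir i) = t.
Proof.
by rewrite /axial /dir; case: (i <= 3)%N; [|case: (i <= 6)%N];
  rewrite ?coordE /= ?mulr1 ?mulrN1 ?opprK.
Qed.

(** Close to [p_i] the point [trop (psi x)] is far out in the direction [dir i],
    while its retraction stays at the parameter [val p_i]. *)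
Lemma gamma_axis i : (1 <= i <= 9)%N ->
  exists k, [/\ (1 <= k <= 9)%N, gamma (rval nu (p i)) = vtx k & dir k = dir i].
Proof.
move=> i9; have [N iN] := in_range_exists (rval nu (p i)).
pose rest := \sum_(1 <= j < 10 | j != i) fine (exc (p i) j) *: dir j.
pose S := \sum_(1 <= k < 10) `|axial i (vtx k)|.
(* Beyond [M] the axial coordinate exceeds that of every vertex. *)
pose M := S + `|axial i (generic_trop N (rval nu (p i)))| + `|axial i rest| + 1.
have [B HB] := near_p M i9.
have [x xp xB] := approach_exists q0 qpos B (p_neq0 i9).
have [x0 xE ox Mx oth] := HB x xp xB.
have [t pt] := gamma_path x0 ox; rewrite xE in pt.
apply: (path_far C_form C_corner pt) => k k9.
have kS : `|axial i (vtx k)| <= S.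
  by rewrite /S (bigD1_seq k) ?iota_uniq ?mem_index_iota //= lerDl sumr_ge0.
rewrite (trop_psiE x0 _ ox (N := N)) ?xE //.
rewrite (excess_vector_split _ i9) !axialD axial_dir_self.
have -> : \sum_(1 <= j < 10 | j != i) fine (exc x j) *: dir j = rest.
  rewrite /rest big_nat_cond [RHS]big_nat_cond; apply: eq_bigr => j /andP[j9 ji].
  by rewrite oth.
have := ler_norm (axial i (vtx k)); have := ler_norm (- axial i rest).
have := ler_norm (- axial i (generic_trop N (rval nu (p i)))); rewrite !normrN.
by move: kS Mx; rewrite /M => *; lra.
Qed.

(** The real lifts of the classes run through one period, and partners have
    equal lifts or the two ends of the period as lifts; any other two lifts
    differ by a nonzero amount less than [val q]. *)
Lemma same_class_p i j : (1 <= i <= 9)%N -> (1 <= j <= 9)%N ->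
  same_class nu q (p i) (p j) <-> j = i \/ j = partner i.
Proof.
move=> i9 j9.
have [s [t [tE [/andP[t12 t23] t34 /andP[t45 t56] t67 [/andP[t78 t89] t91]]]]] := he_cyclic psi_emb.
have tdiff : same_class nu q (p i) (p j) <-> exists m : int, t i - t j = m%:~R * Q.
  have [n en] := tE i i9; have [m em] := tE j j9.
  case: (s) en em => /=; rewrite ?expr0 ?expr1 ?mul1r ?mulN1r => en em; split=> -[k ek].
  - by exists (m - n + k); rewrite !intrD mulrNz; lra.
  - by exists (n - m + k); rewrite !intrD mulrNz; lra.
  - by exists (m - n - k); rewrite !intrD !mulrNz; lra.
  - by exists (m - n - k); rewrite !intrD !mulrNz; lra.
rewrite tdiff; split; last first.
{ case=> ->; first by exists 0; rewrite mul0r subrr.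
  move: i i9 {j9 tdiff}; apply: index_cases; do 2!split; rewrite /partner /=.
  all: first [by exists 0; rewrite mulr0z mul0r; lra|by exists 1; rewrite mulr1z mul1r; lra|
              by exists (-1); rewrite mulrN1z mulN1r; lra]. }
move=> [m em]; suff /orP[/eqP ->|/eqP ->] : (j == i) || (j == partner i) by [left|right|].
apply: contraT => ne.
have no (k : int) : 0 < k%:~R * Q < Q -> False.
  case/andP; rewrite pmulr_lgt0 // ltr0z => k0.
  rewrite -[ltRHS]mul1r ltr_pM2r // -[1]/(1%:~R) ltr_int.
  by case: k k0 => [[|k]|k].
have [d|d] : (0 < m%:~R * Q < Q) \/ (0 < - (m%:~R * Q) < Q).
  rewrite -em; move: ne {em tdiff tE}; move: j j9; apply: index_cases; move: i i9; apply: index_cases.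
  do 4!split; rewrite //= => _; first [by left; apply/andP; split; lra | by right; apply/andP; split; lra].
- by case: (no m).
- by case: (no (- m)); rewrite mulrNz mulNr.
Qed.

Lemma dir_inj_axis i k : (1 <= i <= 9)%N -> (1 <= k <= 9)%N ->
  dir k = dir i -> dir (partner k) = dir (partner i) -> partner i <> i -> k = i.
Proof.
have d1 : (1 : R) <> 0 by apply/eqP; exact: oner_neq0.
have d2 : (0 : R) <> -1 by move=> ?; lra.
have d3 : (1 : R) <> -1 by move=> ?; lra.
move=> i9 k9 /coord_eq e /coord_eq e'; move: e e'.
move: k k9; apply: index_cases; move: i i9; apply: index_cases.
do 4!split; rewrite /dir /= => -[? ?] [? ?] ?; first [by []|exfalso; lra].
Qed.

Lemma partner_dir i : (1 <= i <= 9)%N -> partner i <> i -> dir (partner i) <> dir i.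
Proof.
move=> i9 pi /coord_eq; move: i i9 pi; apply: index_cases.
by do 2!split; rewrite /dir /= => // _ [? ?]; exfalso; lra.
Qed.

Lemma dir_inj_single i k : (1 <= i <= 9)%N -> (1 <= k <= 9)%N ->
  dir k = dir i -> partner i = i -> partner k = k -> k = i.
Proof.
move=> i9; move: k; move: i i9; apply: index_cases; do 2!split; apply: index_cases; do 2!split;
  by rewrite /partner /dir //= => /coord_eq[/= ? ?] _ _; exfalso; lra.
Qed.

(** Partners have the same class, so their common vertex carries rays of both
    directions, which determines it.  A ray without partner then has to use the
    remaining vertex of its axis, because the others are taken by different
    classes. *)
Lemma gamma_vtx i : (1 <= i <= 9)%N -> gamma (rval nu (p i)) = vtx i.
Proof.
have pair j : (1 <= j <= 9)%N -> partner j <> j -> gamma (rval nu (p j)) = vtx j.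
  move=> j9 pj; have pj9 := partner_range j9.
  have [k [k9 ek kd]] := gamma_axis j9.
  have [k' [k'9 ek' k'd]] := gamma_axis pj9.
  have e : gamma (rval nu (p j)) = gamma (rval nu (p (partner j))).
    by apply/gamma_class/same_class_p => //; right.
  have [kk|kk] := vtx_inj C_form C_corner k9 k'9 (etrans (esym ek) (etrans e ek')).
    by case: (partner_dir j9 pj); rewrite -k'd kk kd.
  by rewrite ek (dir_inj_axis j9 k9 kd _ pj) // -kk.
have [pi|/eqP pi] := eqVneq (partner i) i => i9; last exact: pair.
have [k [k9 ek kd]] := gamma_axis i9.
have [pk|/eqP pk] := eqVneq (partner k) k; last first.
  have /gamma_class/(same_class_p i9 k9) : gamma (rval nu (p i)) = gamma (rval nu (p k)).
    by rewrite ek pair.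
  by rewrite pi => -[] ki; case: pk; rewrite ki.
by rewrite ek (dir_inj_single i9 k9 kd pi pk).
Qed.

Lemma excess_not_class x i : ~ same_class nu q x (p i) -> exc x i = 0%E.
Proof. by move=> no; rewrite /excess asboolF. Qed.

(** Here [trop (psi w)] retracts to a point that is not a vertex, and only
    vertices are retractions of points outside the hexagon. *)
Lemma generic_off_class N w : w != 0 -> in_range N (rval nu w) ->
  (forall i, (1 <= i <= 9)%N -> ~ same_class nu q w (p i)) ->
  generic_trop N (rval nu w) = gamma (rval nu w).
Proof.
move=> w0 wN no.
have e0 i : (1 <= i <= 9)%N -> exc w i = 0%E by move=> i9; rewrite excess_not_class //; exact: no.
have ow : off_axes (psi w).
  by apply/(off_axesP w0) => i i9; rewrite e0.
have := trop_psiE w0 wN ow.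
have -> : excess_vector w = 0.
  rewrite /excess_vector big_nat_cond big1 // => i /andP[i9 _].
  by rewrite e0 // scale0r.
rewrite addr0 => <-.
have [t /(path_arm C_form C_corner)[[_ -> _] //|[i [s' [i9 ev _ _]]]]] := gamma_path w0 ow.
by case: (no i i9); apply/gamma_class; rewrite ev gamma_vtx.
Qed.

Lemma root_exists n : (0 < n)%N -> exists r : K, r ^+ n = q.
Proof.
case: n => // n _; have [r rE] := solve_monicpoly (fun i => if i == 0%N then q else 0) (ltn0Sn n).
by exists r; rewrite rE big_ord_recl /= expr0 mulr1 big1 ?addr0 // => i _; rewrite mul0r.
Qed.

(** Two distinct points of one class are at least [val q] apart. *)
Lemma class_gap (s D : R) : exists2 e : R, 0 < e &
  forall d, 0 < d < e -> forall n : int, s + d + n%:~R * Q <> D.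
Proof.
pose m := Num.ceil ((D - s) / Q) - 1.
have mD : m%:~R * Q < D - s <= (m + 1)%:~R * Q.
  rewrite -ltr_pdivlMr // -ler_pdivrMr // /m subrK.
  by have := Num.Theory.ceil_itv ((D - s) / Q).
exists (D - s - m%:~R * Q); first by case/andP: mD; rewrite subr_gt0.
move=> d /andP[d0 dlt] n e; have dE : d = D - s - n%:~R * Q by lra.
have mn : m < n.
  by rewrite -(ltr_int R) -(ltr_pM2r Q0); lra.
have nm : n < m + 1.
  by rewrite -(ltr_int R) -(ltr_pM2r Q0); case/andP: mD => _; lra.
by move: nm; rewrite ltzD1 leNgt mn.
Qed.

Lemma ptheta_continuous N : continuous (ptheta nu q N).
Proof.
have sumc (F : nat -> R -> R) : (forall i, continuous (F i)) ->
    continuous (fun s : R => \sum_(0 <= i < N) F i s).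
  move=> Fc; elim: N => [|n IH] s.
    by under eq_fun do rewrite big_geq //; exact: cst_continuous.
  under eq_fun do rewrite big_nat_recr //=.
  by apply: cvgD; [exact: IH|exact: Fc].
move=> s; apply: cvgD; apply: sumc => i t.
  apply: (@continuous_min _ _ (cst 0) (fun s : R => i.+1%:R * Q + s)); first exact: cst_continuous.
  by apply: cvgD; [exact: cvg_cst|exact: cvg_id].
apply: (@continuous_min _ _ (cst 0) (fun s : R => i%:R * Q - s)); first exact: cst_continuous.
by apply: cvgB; [exact: cvg_cst|exact: cvg_id].
Qed.

Lemma theta_at_continuous N i : continuous (theta_at N i).
Proof.
move=> s; apply: (@continuous_comp _ _ _ (fun s => s - rval nu (p i)) (ptheta nu q N)).
  by apply: cvgB; [exact: cvg_id|exact: cvg_cst].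
exact: ptheta_continuous.
Qed.

Lemma generic_trop_continuous N : continuous (generic_trop N).
Proof.
have sumc (u v : R) i j k l m n : continuous (fun s : R =>
    u + theta_at N i s + theta_at N j s + theta_at N k s -
    (v + theta_at N l s + theta_at N m s + theta_at N n s)).
  move=> s; apply: cvgB; repeat (apply: cvgD; last exact: theta_at_continuous); exact: cvg_cst.
move=> s; exact: (cvg_pair (sumc _ _ _ _ _ _ _ _ s) (sumc _ _ _ _ _ _ _ _ s)).
Qed.

(** The values [val z + val q / n] are realized by multiplying [z] by an [n]-th
    root of [q].  For large [n] they avoid the classes of all [p_i], so that
    [generic_off_class] applies; both sides are continuous. *)
Lemma generic_tropE z : z != 0 -> exists2 N, in_range N (rval nu z) &
  generic_trop N (rval nu z) = gamma (rval nu z).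
Proof.
move=> z0; set s := rval nu z.
(* One more factor than needed at [s], to cover all [s + Q / n]. *)
have [N0 N0s] := in_range_exists s.
pose f n : R := s + Q / n.+1%:R.
have fN n : in_range N0.+1 (f n).
  move=> i i9; have := N0s i i9; rewrite /f -[N0.+1]addn1 natrD mulrDl mul1r.
  have : 0 <= Q / n.+1%:R <= Q.
    apply/andP; split; first by rewrite divr_ge0 // ltW.
    by rewrite ler_pdivrMr ?ltr0n // ler_peMr ?(ltW Q0) // ler1n.
  have := Q0; rewrite !ltr_norml; move: (Q / n.+1%:R) (N0%:R * Q) => x y ? /andP[? ?] /andP[? ?].
  by apply/andP; split; lra.
exists N0.+1.
  by move=> i i9; apply: lt_trans (N0s i i9) _; rewrite ltr_pM2r // ltr_nat.
have [n0 n0P] : exists n0, forall n, (n0 <= n)%N -> forall i, (1 <= i <= 9)%N ->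
    forall k : int, f n + k%:~R * Q <> rval nu (p i).
  suff H m : exists n0, forall n, (n0 <= n)%N -> forall i, (1 <= i <= m)%N ->
      forall k : int, f n + k%:~R * Q <> rval nu (p i) by exact: H.
  elim: m => [|m [n0 IH]]; first by exists 0%N => n _ i; rewrite lt0n leqn0 => /andP[/negbTE ->].
  have [e e0 eP] := class_gap s (rval nu (p m.+1)).
  exists (maxn n0 (Num.truncn (Q / e))) => n; rewrite geq_max => /andP[n0n en] i /andP[i1].
  rewrite leq_eqVlt => /predU1P[->|im]; last by apply: IH; rewrite ?i1.
  apply: eP; rewrite divr_gt0 ?ltr0n //= ltr_pdivrMr ?ltr0n // mulrC -ltr_pdivrMr //.
  by apply: lt_le_trans (truncnS_gt _) _; rewrite ler_nat.
have eqf n : (n0 <= n)%N -> generic_trop N0.+1 (f n) = gamma (f n).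
  move=> n0n; have [r rq] := root_exists (ltn0Sn n).
  have r0 : r != 0 by apply: contraNneq q0 => r0; rewrite -rq r0 expr0n.
  have rr : rval nu r = Q / n.+1%:R.
    by rewrite -rq rvalX // [_ * rval nu r]mulrC mulfK // pnatr_eq0.
  have fE : f n = rval nu (z * r) by rewrite rvalM // rr.
  have zr0 : z * r != 0 by rewrite mulf_neq0.
  rewrite fE; apply: generic_off_class => //; first by rewrite -fE; exact: fN.
  by move=> i i9 [k]; rewrite -fE; exact: n0P.
have fs : f n @[n --> \oo] --> s.
  rewrite -[X in _ --> X]addr0; apply: cvgD; first exact: cvg_cst.
  rewrite -[X in _ --> X](mulr0 Q); apply: cvgM; first exact: cvg_cst.
  exact: cvg_harmonic.
have c1 : generic_trop N0.+1 (f n) @[n --> \oo] --> generic_trop N0.+1 s.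
  exact: (continuous_cvg _ (@generic_trop_continuous _ s) fs).
have c2 : gamma (f n) @[n --> \oo] --> gamma s.
  exact: (continuous_cvg _ (hi_continuous gamma_id (x := s)) fs).
apply: (cvg_unique (@norm_hausdorff R (R * R)%type) c1); apply: cvg_trans c2; apply: near_eq_cvg.
by exists n0 => // n /= n0n; rewrite eqf.
Qed.

Lemma trop_gamma z : z != 0 -> off_axes (psi z) -> trop_psi z = gamma (rval nu z) + excess_vector z.
Proof.
move=> z0 oz; have [N zN <-] := generic_tropE z0.
exact: trop_psiE.
Qed.

Lemma same_class_trans x y w : same_class nu q x y -> same_class nu q y w -> same_class nu q x w.
Proof. by move=> [n e] [m e']; exists (n + m); rewrite -e' -e intrD mulrDl addrA. Qed.

Lemma same_class_sym x y : same_class nu q x y -> same_class nu q y x.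
Proof. by move=> [n e]; exists (- n); rewrite -e mulrNz mulNr addrK. Qed.

Lemma trop_arm z i : (1 <= i <= 9)%N -> z != 0 -> off_axes (psi z) -> same_class nu q z (p i) ->
  trop_psi z = arm_pt i (fine (exc z i))
     (if partner i == i then 0 else fine (exc z (partner i))).
Proof.
move=> i9 z0 oz zi; rewrite trop_gamma // (excess_vector_split _ i9).
have -> : gamma (rval nu z) = vtx i by rewrite -gamma_vtx //; exact/gamma_class.
have other j : (1 <= j <= 9)%N -> j != i -> j != partner i -> exc z j = 0%E.
  move=> j9 /eqP ji /eqP jp; apply: excess_not_class => zj.
  have /(same_class_p i9 j9)[] // := same_class_trans (same_class_sym zi) zj.
rewrite /arm_pt -addrA; congr (_ + (_ + _)).
case: eqP => [pi|/eqP pi].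
  rewrite scale0r big_nat_cond big1 // => j /andP[j9 ji].
  by rewrite other ?scale0r // pi.
have pi9 := partner_range i9.
rewrite big_mkcond (bigD1_seq (partner i)) ?iota_uniq ?mem_index_iota //= pi big_nat_cond.
rewrite big1 ?addr0 // => j /andP[j9 jp]; case: ifP => // ji.
by rewrite other ?scale0r.
Qed.

(** * The fibers of the tropical group law *)

Lemma psi_qZ x y : x != 0 -> y != 0 -> qZ q (x / y) -> off_axes (psi x) ->
  off_axes (psi y) /\ trop_psi y = trop_psi x.
Proof.
move=> x0 y0 /(he_inj psi_emb x0 y0)[k k0 [e1 e2 e3]] [a1 a2 a3].
split; first by split; rewrite ?e1 ?e2 ?e3 mulf_neq0.
rewrite /Defs.trop_psi /trop e1 e2 e3 (rvalM nu k0 a1) (rvalM nu k0 a2) (rvalM nu k0 a3).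
by congr pair; rewrite opprD addrACA subrr add0r.
Qed.

Lemma lift_exists U : trop_curve nu C U -> exists u, is_lift u U.
Proof.
move=> [z [zC [z1 z2 z3] <-]]; have [x x0 [k k0 [e1 e2 e3]]] := he_surj psi_emb zC.
have nz w t : w != 0 -> w = k * t -> t != 0.
  by move=> w0 e; apply: contraNneq w0 => t0; rewrite e t0 mulr0.
have n1 := nz _ _ z1 e1; have n2 := nz _ _ z2 e2; have n3 := nz _ _ z3 e3.
exists x; split => //.
rewrite /Defs.trop_psi /trop e1 e2 e3 (rvalM nu k0 n1) (rvalM nu k0 n2) (rvalM nu k0 n3).
by congr pair; rewrite opprD addrACA subrr add0r.
Qed.

Lemma gamma_circle_coord u U : is_lift u U ->
  exists n : int, circle_coord nu C gamma U = rval nu u + n%:~R * Q.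
Proof.
move=> [u0 ou uU]; have e := hi_retraction gamma_id u0 ou; rewrite uU in e.
rewrite /circle_coord; case: xgetP => [s -> /=|/(_ (rval nu u))[]//].
rewrite e => /(hi_periodic gamma_id)[n en]; exists n; rewrite -en; ring.
Qed.

Lemma neg_circ_lift u v U V : is_lift u U -> is_lift v V ->
  neg_circ nu C gamma U V = gamma (rval nu (u^-1 * v^-1)).
Proof.
move=> lu lv; have [n en] := gamma_circle_coord lu; have [m em] := gamma_circle_coord lv.
have [[u0 _ _] [v0 _ _]] := (lu, lv).
rewrite /neg_circ en em; apply/(hi_periodic gamma_id); exists (- (n + m)).
by rewrite rvalM ?invr_neq0 // !rvalV // mulrNz intrD; ring.
Qed.

(** The third point of a triple can be moved to [(u v)^-1] by a power of [q]. *)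
Lemma fiberP U V W : fiber U V W <-> exists u v,
  [/\ is_lift u U, is_lift v V, off_axes (psi (u^-1 * v^-1)) & trop_psi (u^-1 * v^-1) = W].
Proof.
split=> [[x [y [z [/= lx ly [z0 oz <-] xyz]]]]|[u [v [lu lv oz <-]]]].
  have [[x0 _ _] [y0 _ _]] := (lx, ly).
  have z'0 : x^-1 * y^-1 != 0 by rewrite mulf_neq0 ?invr_neq0.
  have zz : qZ q (z / (x^-1 * y^-1)) by rewrite invfM !invrK mulrC.
  by have [oz' <-] := psi_qZ z0 z'0 zz oz; exists x, y.
have [[u0 _ _] [v0 _ _]] := (lu, lv).
have z0 : u^-1 * v^-1 != 0 by rewrite mulf_neq0 ?invr_neq0.
exists u, v, (u^-1 * v^-1); split => //; exists 0.
by rewrite expr0z mulrACA !mulfV // mulr1.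
Qed.

Lemma arm_class z i : (1 <= i <= 9)%N -> z != 0 -> off_axes (psi z) -> same_class nu q z (p i) ->
  let e := fine (exc z i) in let e' := if partner i == i then 0 else fine (exc z (partner i)) in
  trop_psi z = arm_pt i e e' /\ (arm i e e' \/ arm (partner i) e' e).
Proof.
move=> i9 z0 oz zi e e'; have eT := trop_arm i9 z0 oz zi; split => //.
have [t pt] := gamma_path z0 oz; rewrite eT in pt.
have ev : gamma (rval nu z) = vtx i by rewrite -gamma_vtx //; exact/gamma_class.
rewrite ev in pt; apply: (arm_of_path C_form C_corner i9 _ pt).
by rewrite /e' => ->; rewrite eqxx.
Qed.

(** Near [p_i] the coordinate along [dir i] grows without bound while the one
    along the direction of the partner is constant; the larger coordinate decides
    on which ray the point lies. *)
Lemma towards_ray i : (1 <= i <= 9)%N -> towards (ray i) (p i).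
Proof.
move=> i9 M.
pose e' : R := if partner i == i then 0 else fine (exc (p i) (partner i)).
pose B := `|M| + `|vtx i + e' *: dir (partner i)| + `|e'| + 1.
have [N HN] := near_p B i9.
exists N => x x0 xp xN; have [_ xE ox xB oth] := HN x xp xN.
have xi : same_class nu q x (p i) by exists 0; rewrite mul0r addr0.
have pi9 := partner_range i9.
have [eT ar] := arm_class i9 x0 ox xi; move: eT ar.
have -> : (if partner i == i then 0 else fine (exc x (partner i))) = e'.
  by rewrite /e'; case: eqP => // /eqP pi; rewrite oth.
set e := fine (exc x i) in xB *; move=> eT ar.
have e'e : e' < e.
  apply: le_lt_trans (ler_norm _) _; apply: lt_le_trans xB; rewrite /B.
  by rewrite ltr_pwDr // lerDr addr_ge0.
case: ar => [ar|[_ _ + _]]; last by rewrite leNgt e'e.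
split=> //.
  have [_ _ _ [ee|el]] := ar; first by move: e'e; rewrite ee ltxx.
  by rewrite eT el; apply: (arm_ray C_form C_corner) => //; rewrite -el.
have n1 : `|dir i| = 1.
  rewrite norm_pair /dir; case: ifP => _; last case: ifP => _;
    by rewrite /= ?normrN ?normr0 ?normr1 ?maxxx // /Num.max ?ltr10 ?ltr01 //; case: ifP.
have -> : trop_psi x = (vtx i + e' *: dir (partner i)) + e *: dir i by rewrite eT /arm_pt addrAC.
have := ler_norm M; have := ler_norm e; have := normr_ge0 e'.
have := lerB_normD (e *: dir i) (vtx i + e' *: dir (partner i)).
rewrite [e *: _ + _]addrC normrZ n1 mulr1.
by move: xB; rewrite /B => *; lra.
Qed.

(** The image of [psi] near [p_i] is far out on both the rays [i] and [k], and
    different rays have at most one common point. *)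
Lemma towards_inj i k : (1 <= i <= 9)%N -> (1 <= k <= 9)%N -> towards (ray k) (p i) -> k = i.
Proof.
move=> i9 k9 tk; pose M := `|foot nu C i| + 1.
have [N1 H1] := tk M; have [N2 H2] := towards_ray i9 M.
have pi0 := p_neq0 i9; pose B := Num.max (Num.max N1 N2) (rval nu (p i) + 1).
have [x xp xB] := approach_exists q0 qpos B pi0.
have xN N : N <= B -> (N%:E <= nu (x - p i)%R)%E by move=> NB; apply: le_trans xB; rewrite lee_fin.
have ltx : (nu (p i) < nu (x - p i)%R)%E.
  by apply: lt_le_trans (xN _ (lexx _)); rewrite (vfunE nu pi0) lte_fin !lt_max ltrDl ltr01 orbT.
have [x0 _ _] := excess_near q0 qpos pi0 xp ltx.
have B1 : N1 <= B by rewrite /B !le_max lexx.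
have B2 : N2 <= B by rewrite /B !le_max lexx orbT.
have [_ W1 _] := H1 x x0 xp (xN _ B1).
have [_ W2 MW] := H2 x x0 xp (xN _ B2).
have [//|W] := ray_ray C_form C_corner k9 i9 W1 W2.
by move: MW; rewrite W /M gerDl ler10.
Qed.

Lemma arm_pt_swap i s s' : (1 <= i <= 9)%N -> arm_pt (partner i) s s' = arm_pt i s' s.
Proof. by move=> i9; rewrite /arm_pt partnerK // vtx_partner // addrAC. Qed.

Section Fiber.
Context (U V : R * R).
Hypotheses (U_trop : trop_curve nu C U) (V_trop : trop_curve nu C V).
Local Notation P := (neg_circ nu C gamma U V).
Local Notation d u v i := (delta nu q (u^-1 * v^-1) (p i)).

Lemma fiber_class u v i : (1 <= i <= 9)%N -> P = vtx i -> is_lift u U -> is_lift v V ->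
  [/\ u^-1 * v^-1 != 0, same_class nu q (u^-1 * v^-1) (p i) &
    forall j, j = i \/ j = partner i -> exc (u^-1 * v^-1) j = d u v j].
Proof.
move=> i9 eP lu lv; have [[u0 _ _] [v0 _ _]] := (lu, lv).
have zi : same_class nu q (u^-1 * v^-1) (p i).
  by apply/gamma_class; rewrite -(neg_circ_lift lu lv) gamma_vtx.
split=> [||j ji]; first by rewrite mulf_neq0 ?invr_neq0.
  exact: zi.
rewrite /excess asboolT //; apply: same_class_trans zi _; apply/same_class_p => //.
by case: ji => ->; rewrite ?partner_range.
Qed.

(** All [(u v)^-1] are in the class of the parameter of [P], which is not the
    class of any [p_i]; hence [psi] is defined there and takes the value [P]. *)
Lemma fiber_off_vertex : ~ hex_vertex nu C P -> fiber U V = [set P].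
Proof.
move=> nv.
have inP u v : is_lift u U -> is_lift v V -> off_axes (psi (u^-1 * v^-1)) -> trop_psi (u^-1 * v^-1) = P.
  move=> lu lv oz; have [[u0 _ _] [v0 _ _]] := (lu, lv).
  have z0 : u^-1 * v^-1 != 0 by rewrite mulf_neq0 ?invr_neq0.
  have [t] := gamma_path z0 oz; rewrite -(neg_circ_lift lu lv).
  move/(path_arm C_form C_corner) => [[_ -> _] //|[i [s' [i9 ev _ _]]]].
  by case: nv; apply/(hex_vertexP C_form C_corner); exists i.
apply/seteqP; split=> W.
  by move=> /fiberP[u [v [lu lv oz <-]]]; exact: inP.
move=> ->; have [u lu] := lift_exists U_trop; have [v lv] := lift_exists V_trop.
have [[u0 _ _] [v0 _ _]] := (lu, lv).
have z0 : u^-1 * v^-1 != 0 by rewrite mulf_neq0 ?invr_neq0.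
have oz : off_axes (psi (u^-1 * v^-1)).
  apply/(off_axesP z0) => i i9; rewrite excess_not_class // => /gamma_class.
  rewrite -(neg_circ_lift lu lv) gamma_vtx // => ev; case: nv.
  by apply/(hex_vertexP C_form C_corner); exists i.
by apply/fiberP; exists u, v; split => //; exact: inP.
Qed.

Lemma off_axes_class z i : (1 <= i <= 9)%N -> z != 0 -> same_class nu q z (p i) ->
  exc z i \is a fin_num -> exc z (partner i) \is a fin_num -> off_axes (psi z).
Proof.
move=> i9 z0 zi fi fp; apply/(off_axesP z0) => j j9.
have [->//|/eqP ji] := eqVneq j i; have [->//|/eqP jp] := eqVneq j (partner i).
rewrite excess_not_class // => zj.
by have /(same_class_p i9 j9)[] := same_class_trans (same_class_sym zi) zj.
Qed.

(** Here [trop (psi (u v)^-1)] is [vtx i + s dir i], where [s] is the value of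
    [delta] at [p_i], and the point is determined by [s].  A finite distance
    excludes lifts with [psi (u v)^-1] on a coordinate line. *)
Lemma fiber_ray i : (1 <= i <= 9)%N -> partner i = i -> P = vtx i ->
  fiber U V = [set W | ray i W /\ exists u v, [/\ is_lift u U, is_lift v V
                           & (hex_distance nu C W)%:E = d u v i]].
Proof.
move=> i9 pi eP; have l0 : len i = 0.
  by have [_] := len_ge0 C_form C_corner i9; rewrite pi eqxx => /eqP <-.
apply/seteqP; split=> W.
  move=> /fiberP[u [v [lu lv oz <-]]]; have [z0 zi de] := fiber_class i9 eP lu lv.
  have [-> ar] := arm_class i9 z0 oz zi; rewrite pi eqxx in ar *.
  have {}ar : arm i (fine (exc (u^-1 * v^-1) i)) 0.
    case: ar => // -[e0 _ e1 _].
    have -> : fine (exc (u^-1 * v^-1) i) = 0 by apply/le_anti; rewrite e0 e1.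
    by have [] := arm0 C_form C_corner i9.
  split; first by rewrite -l0; apply: (arm_ray C_form C_corner) => //; rewrite l0.
  exists u, v; split => //; rewrite (hex_distance_arm C_form C_corner) //.
  rewrite -(de i (or_introl erefl)) fineK //; exact: (iffLR (off_axesP z0) oz).
move=> [/(ray_arm C_form C_corner i9)[s sa ->] [u [v [lu lv]]]].
rewrite (hex_distance_arm C_form C_corner) // => sE.
have [z0 zi de] := fiber_class i9 eP lu lv.
have fin : exc (u^-1 * v^-1) i = s%:E by rewrite de //; left.
have oz : off_axes (psi (u^-1 * v^-1)) by apply: (off_axes_class i9 z0 zi); rewrite ?pi fin.
apply/fiberP; exists u, v; split => //.
by have [-> _] := arm_class i9 z0 oz zi; rewrite pi eqxx fin l0.
Qed.

(** The two values of [delta] at [p_i] and [p_k] are the coordinates of the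
    point behind the vertex.  They agree on the segment; otherwise the larger one
    tells the ray, and the smaller one is then the length of the segment. *)
Lemma fiber_segment i : (1 <= i <= 9)%N -> partner i <> i -> P = vtx i ->
  let k := partner i in let dist W := (hex_distance nu C W)%:E in
  fiber U V =
    [set W | seg (corner i) W /\ exists u v, [/\ is_lift u U, is_lift v V,
        dist W = d u v i & d u v i = d u v k]]
    `|` [set W | ray i W /\ exists u v, [/\ is_lift u U, is_lift v V,
        dist W = d u v i & (d u v k < d u v i)%E]]
    `|` [set W | ray k W /\ exists u v, [/\ is_lift u U, is_lift v V,
        dist W = d u v k & (d u v i < d u v k)%E]].
Proof.
move=> i9 pi eP k dist; have k9 : (1 <= k <= 9)%N := partner_range i9.
have pk : partner k = i by exact: partnerK.
have hd j s s' : (1 <= j <= 9)%N -> arm j s s' -> dist (arm_pt j s s') = s%:E.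
  by move=> j9 ja; rewrite /dist (hex_distance_arm C_form C_corner).
have sides u v (lu : is_lift u U) (lv : is_lift v V) : off_axes (psi (u^-1 * v^-1)) ->
    exists e e', [/\ d u v i = e%:E, d u v k = e'%:E, trop_psi (u^-1 * v^-1) = arm_pt i e e' &
      arm i e e' \/ arm k e' e].
  move=> oz; have [z0 zi de] := fiber_class i9 eP lu lv.
  have := arm_class i9 z0 oz zi; move/eqP/negbTE: pi => -> [eT ar].
  exists (fine (exc (u^-1 * v^-1) i)), (fine (exc (u^-1 * v^-1) k)).
  have fin := iffLR (off_axesP z0) oz.
  by split => //; rewrite -de ?fineK ?fin //; [left|right].
have finite u v (lu : is_lift u U) (lv : is_lift v V) (s : R) :
    Order.max (d u v i) (d u v k) = s%:E -> off_axes (psi (u^-1 * v^-1)).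
  move=> ms; have [z0 zi de] := fiber_class i9 eP lu lv.
  have bound j : j = i \/ j = k -> exc (u^-1 * v^-1) j \is a fin_num.
    move=> jik; rewrite fin_numElt; have j9 : (1 <= j <= 9)%N by case: jik => ->.
    rewrite (lt_le_trans ltNy0 (excess_ge0 q0 qpos z0 (p_neq0 j9))) /=.
    apply: le_lt_trans (ltry s); rewrite -ms de // le_max.
    by case: jik => ->; rewrite lexx ?orbT.
  by apply: (off_axes_class i9 z0 zi); apply: bound; [left|right].
apply/seteqP; split=> W.
  move=> /fiberP[u [v [lu lv oz <-]]]; have [e [e' [de de' -> ar]]] := sides u v lu lv oz.
  have [ee|ee|ee] := ltgtP e e'.
  - right; case: ar => [[_ _ + _]|sa]; first by rewrite leNgt ee.
    have [_ _ _ [e1|e1]] := sa; first by move: ee; rewrite e1 ltxx.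
    split; first by rewrite -arm_pt_swap // e1; apply: (arm_ray C_form C_corner) => //; rewrite -e1.
    by exists u, v; split; rewrite // ?de ?de' ?lte_fin // -arm_pt_swap // hd.
  - left; right; case: ar => [sa|[_ _ + _]]; last by rewrite leNgt ee.
    have [_ _ _ [e1|e1]] := sa; first by move: ee; rewrite e1 ltxx.
    split; first by rewrite e1; apply: (arm_ray C_form C_corner) => //; rewrite -e1.
    by exists u, v; split; rewrite // ?de ?de' ?lte_fin // hd.
  - left; left; subst e'; have sa : arm i e e.
      by case: ar => // -[]; rewrite len_partner.
    split; first by apply/(seg_arm C_form C_corner) => //; exists e.
    by exists u, v; split; rewrite // ?de ?de' // hd.
case=> [[|]|] [].
- move=> /(seg_arm C_form C_corner _ i9 pi)[s sa ->] [u [v [lu lv]]].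
  rewrite hd // => di dik; apply/fiberP; exists u, v.
  have oz : off_axes (psi (u^-1 * v^-1)) by apply: (finite u v lu lv s); rewrite -dik maxxx.
  have [e [e' [de de' eT _]]] := sides u v lu lv oz; split => //.
  by rewrite eT; move: di dik; rewrite de de' => -[<-] [<-].
- move=> /(ray_arm C_form C_corner i9)[s sa ->] [u [v [lu lv]]].
  rewrite hd // => di dik; apply/fiberP; exists u, v.
  have oz : off_axes (psi (u^-1 * v^-1)) by apply: (finite u v lu lv s); rewrite max_l // ltW.
  have [e [e' [de de' eT ar]]] := sides u v lu lv oz; split => //.
  move: di dik; rewrite de de' lte_fin eT => -[se] ee; rewrite se.
  case: ar => [[_ _ _ [e1|->]]|[_ _ + _]] //; first by move: ee; rewrite e1 ltxx.
  by rewrite leNgt ee.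
- move=> /(ray_arm C_form C_corner k9)[s sa ->] [u [v [lu lv]]].
  rewrite hd // => di dik; apply/fiberP; exists u, v.
  have oz : off_axes (psi (u^-1 * v^-1)) by apply: (finite u v lu lv s); rewrite max_r // ltW.
  have [e [e' [de de' eT ar]]] := sides u v lu lv oz; split => //.
  move: di dik; rewrite de de' lte_fin eT => -[se] ee; rewrite se arm_pt_swap //.
  case: ar => [[_ _ + _]|[_ _ _ [e1|->]]] //; first by rewrite leNgt ee.
  by move: ee; rewrite e1 ltxx.
Qed.

End Fiber.
End Embedding.

Unset Implicit Arguments.

Theorem proposition10 (R : realType) (K : closedFieldType) (nu : valuation R K)
    (q a b c : K) (p : nat -> K) (C : nat -> nat -> nat -> K)
    (gamma : R -> R * R)
    (Kcomplete : vcomplete nu)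
    (residue_char2 : 2%N \notin [pchar (residue_field nu)])
    (residue_char3 : 3%N \notin [pchar (residue_field nu)])
    (q_neq0 : q != 0) (q_pos : (0 < nu q)%E)
    (psi_embedding : honeycomb_embedding nu q a b c p C)
    (gamma_ident : hexagon_identification nu q a b c p C gamma)
    (U V : R * R) (U_trop : trop_curve nu C U) (V_trop : trop_curve nu C V) :
  let P := neg_circ nu C gamma U V in
  let fiber := TGL_fiber nu q a b c p U V in
  let is_lift := is_lift nu q a b c p in
  let towards := towards nu q a b c p in
  let dist W := (hex_distance nu C W)%:E in
  let d u v i := delta nu q (u^-1 * v^-1) (p i) in
  let case1 := ~ hex_vertex nu C P in
  let case2 E i :=
    [/\ vertex_with_ray nu C P E, (1 <= i <= 9)%N & towards E (p i)] in
  let case3 B Ej Ek j k :=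
    [/\ vertex_with_segment nu C P B Ej Ek, (1 <= j <= 9)%N, (1 <= k <= 9)%N,
        towards Ej (p j) & towards Ek (p k)] in
  [/\ exactly_one3 case1 (exists E i, case2 E i)
                   (exists B Ej Ek j k, case3 B Ej Ek j k),
      case1 -> fiber = [set P],
      forall E i, case2 E i ->
        fiber = [set W | E W /\ exists u v, [/\ is_lift u U, is_lift v V
                           & dist W = d u v i]]
    & forall B Ej Ek j k, case3 B Ej Ek j k ->
        fiber =
          [set W | B W /\ exists u v, [/\ is_lift u U, is_lift v V,
              dist W = d u v j
            & d u v j = d u v k]]
          `|` [set W | Ej W /\ exists u v, [/\ is_lift u U, is_lift v V,
              dist W = d u v j
            & (d u v k < d u v j)%E]]
          `|` [set W | Ek W /\ exists u v, [/\ is_lift u U, is_lift v V,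
              dist W = d u v k
            & (d u v j < d u v k)%E]]].
Proof.
move=> P fiber is_lift towards dist d case1 case2 case3.
have C_form := he_form psi_embedding.
have C_corner := corner_neq0 Kcomplete q_neq0 q_pos psi_embedding.
have to_ray := towards_ray Kcomplete q_neq0 q_pos psi_embedding gamma_ident.
have ray_to := towards_inj Kcomplete q_neq0 q_pos psi_embedding gamma_ident.
have rayE := vertex_with_rayP C_form C_corner.
have segE := vertex_with_segmentP C_form C_corner.
have case2P E i : case2 E i ->
    [/\ (1 <= i <= 9)%N, partner i = i, P = vtx nu C i & E = ray nu C i].
  move=> [/rayE[k [k9 pk -> ->]] i9 tk].
  by rewrite -(ray_to i k i9 k9 tk).
have case3P B Ej Ek j k : case3 B Ej Ek j k ->
    [/\ (1 <= j <= 9)%N, partner j <> j, P = vtx nu C j, B = seg nu C (corner j) &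
        [/\ k = partner j, Ej = ray nu C j & Ek = ray nu C k]].
  move=> [/segE[i [i9 pi -> -> [-> ->]]] j9 k9 tj tk].
  have ij := ray_to j i j9 i9 tj; have ik := ray_to k _ k9 (partner_range i9) tk.
  by rewrite -ij -ik.
split.
- have [hv|nhv] := EM (hex_vertex nu C P); last first.
    split.
    + exact: Or31.
    + by case=> _ [E [i [[] hv]]].
    + by case=> _ [B [Ej [Ek [j [k [[] hv]]]]]].
    + by case=> [[E [i [[] hv]]]].
  have [i i9 Pi] := iffLR (hex_vertexP C_form C_corner P) hv.
  split; first have [pi|/eqP pi] := eqVneq (partner i) i.
  + apply: Or32; exists (ray nu C i), i; split => //; last exact: to_ray.
    by apply/rayE; exists i.
  + have pi9 := partner_range i9.
    apply: Or33; exists (seg nu C (corner i)), (ray nu C i), (ray nu C (partner i)), i, (partner i).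
    split => //; [|exact: to_ray|exact: to_ray].
    by apply/segE; exists i.
  + by case.
  + by case.
  + case=> -[E [k /case2P[k9 pk Pk _]]] [B [Ej [Ek [j [l /case3P[j9 pj Pj _ _]]]]]].
    have [jk|jk] := vtx_inj C_form C_corner k9 j9 (etrans (esym Pk) Pj); apply: pj.
      by rewrite jk.
    by rewrite jk !pk.
- exact: (fiber_off_vertex Kcomplete q_neq0 q_pos psi_embedding gamma_ident U_trop V_trop).
- move=> E i /case2P[i9 pi Pi ->].
  exact: (fiber_ray Kcomplete q_neq0 q_pos psi_embedding gamma_ident i9 pi Pi).
- move=> B Ej Ek j k /case3P[j9 pj Pj -> [-> -> ->]].
  exact: (fiber_segment Kcomplete q_neq0 q_pos psi_embedding gamma_ident j9 pj Pj).
Qed.
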